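(* Let $\{g_\omega\}_{\omega\in\Omega}$ be a family of circle endomorphisms satisfying conditions (H0), (H1), (H2), (H3), (H4), (H5) listed in the context, and let $g^n_\omega$ be the associated random dynamical system. Then there exist a set $\tilde\Omega\subset\Omega$ of full $\mathbb P$-measure and $\kappa>1$ such that every pair $(I_0,I_1)$ of disjoint intervals of $\mathbb S^1$ is an $(\omega,\kappa)$-horseshoe for all $\omega\in\tilde\Omega$. Furthermore, for each such pair the return times $\{n_k(\omega)\}_{k\ge0}$ of the horseshoes can be taken to be measurable in $\omega$ and to satisfy $$\lim_{k\to\infty}\frac{n_k(\omega)}{k}=\mathbb E[n_0]\qquad \mathbb P\text{-a.s.}$$
   Context: Setting. $\mathbb S^1=\mathbb R/\mathbb Z$ with arc-length distance $\mathrm{dist}$ and Lebesgue measure $\mathrm{Leb}$; an interval is a connected subset of $\mathbb S^1$ with nonempty interior, $|I|=\mathrm{Leb}(I)$. $(X,\Sigma,\nu)$ is a probability space, $\Omega=X^{\mathbb N}$ with product $\sigma$-algebra and $\mathbb P=\nu^{\otimes\mathbb N}$, $\theta$ is the left shift on $\Omega$. $\{g_\omega\}_{\omega\in\Omega}$ is a family of maps $\mathbb S^1\to\mathbb S^1$ and $g^n_\omega=g_{\theta^{n-1}(\omega)}\circ\dots\circ g_\omega$. For each $\omega$, $g_\omega$ is continuous and, outside a finite set $\mathcal S_\omega$ of non-differentiability points, $\mathcal C^2$ with uniformly bounded first and second derivatives. Let $\mathcal C_\omega=\{x\in\mathbb S^1\setminus\mathcal S_\omega: dg_\omega(x)=0\}$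 and $\mathcal{SC}_\omega=\mathcal S_\omega\cup\mathcal C_\omega$ (random singular set). For $\delta>0$ let $\mathrm{dist}_\delta(x,\mathcal{SC}_\omega)=1$ if $\mathrm{dist}(x,\mathcal{SC}_\omega)>\delta$ and $=\mathrm{dist}(x,\mathcal{SC}_\omega)$ otherwise. The random singular set is $\mathbb P$-a.s. regular if there are $B>1,\beta>0$ such that for $\mathbb P$-a.e. $\omega$: $|dg_\omega(x)|\ge \frac1B\mathrm{dist}(x,\mathcal{SC}_\omega)^\beta$ for all $x\in\mathbb S^1\setminus\mathcal{SC}_\omega$; and $\big|\log|dg_\omega(x)|-\log|dg_\omega(y)|\big|\le B\,\mathrm{dist}(x,y)/\mathrm{dist}(x,\mathcal{SC}_\omega)^\beta$ for all $x,y\in\mathbb S^1\setminus\mathcal{SC}_\omega$ with $\mathrm{dist}(x,y)\le\mathrm{dist}(x,\mathcal{SC}_\omega)/2$. (H0) $g_\omega$ depends only on $\omega_0$; for every $x$ the map $\omega\mapsto g_\omega(x)$ is measurable; for $\mathbb P$-a.e. $\omega$ the map $g_\omega$ is continuous and piecewise $\mathcal C^2$; the random singular set is $\mathbb P$-a.s. regular; $\operatorname{ess\,sup}_{\omega}\|g_\omega\|_{\mathcal C^2(\mathbb S^1\setminus\mathcal S_\omega)}<\infty$. (H1) The Markov process $g^n_\omega$, with transition kernel $\mathcal P_x(A)=\mathbb P(g_\omega(x)\in A)$, has a unique ergodic stationary measure $\mu$, equivalent to Lebesgue, and $(\omega,x)\mapsto\log|dg_\omega(x)|$ is in $L^1(\mathbb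 P\otimes\mu)$. (Stationary: $\mu(A)=\int\mathcal P_x(A)\,d\mu(x)$ for all Borel $A$; ergodic: $\mathbb P\otimes\mu$ is ergodic for $(\omega,x)\mapsto(\theta(\omega),g_\omega(x))$.) (H2) Let $S_n(\omega,x)=\sum_{i=0}^{n-1}\log|dg_{\theta^i(\omega)}(g^i_\omega(x))|$. There are $\lambda>0,\alpha_1>0,C_1\ge1$ such that for Lebesgue-a.e. $x$: $\mathbb P(S_n(\omega,x)<\lambda n)\le C_1 n^{-(4+\alpha_1)}$ for all $n\ge1$. (H3) Let $Z_n(\omega,x,\delta)=\sum_{j=0}^{n-1}-\log\mathrm{dist}_\delta(g^j_\omega(x),\mathcal{SC}_{\theta^j(\omega)})$. There are a function $H(\delta)$ with $H(\delta)\to0$ as $\delta\to0$ and constants $\alpha_2>1$, $C_2\ge1$ such that for Lebesgue-a.e. $x$ and all sufficiently small $\delta>0$: $\mathbb P(Z_n(\omega,x,\delta)>H(\delta)n)\le C_2 n^{-(4+\alpha_2)}$ for all $n\ge1$. An interval $I$ is $(\omega,\kappa_0,K)$-full branch expanding ($\kappa_0>1$) if there are $J\subset I$ and $i\le K$ with $g^i_\omega(J)=\mathbb S^1$ and $|dg^i_\omega|>\kappa_0$ on $J$. (H4) There is $\kappa_0>1$ such that for all sufficiently small $\eta>0$ there are $K\in\mathbb N$ and $\iota\in(0,1)$ such that every interval $I$ with $\frac\eta4\le|I|\le4\eta$ satisfies $\mathbb P\{I\text{ is }(\omega,\kappa_0,K)\text{-full branch expanding}\}>\iota$. (H5) For $\mathbb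 P$-a.e. $\omega$ there is an interval $I_\omega$ with $g_\omega(I_\omega)=\mathbb S^1$, and $\inf_{\omega}\inf_{x\in I_\omega}|dg_\omega(x)|>1$. Definition (horseshoe). For disjoint intervals $I_0,I_1$, $\omega\in\Omega$, $\kappa>1$, the pair $(I_0,I_1)$ is an $(\omega,\kappa)$-horseshoe if there are a strictly increasing sequence of nonnegative integers (return times) $\{n_k(\omega)\}_{k\ge0}$ with $\limsup_k n_k(\omega)/k<\infty$ and subsets $J(k,\omega)_{i,j}\subset I_i$ ($k\ge0$, $i,j\in\{0,1\}$) with $g^{n_{k+1}(\omega)-n_k(\omega)}_{\theta^{n_k(\omega)}(\omega)}(J(k,\omega)_{i,j})=I_j$ and $\big|dg^{n_{k+1}(\omega)-n_k(\omega)}_{\theta^{n_k(\omega)}(\omega)}\big|>\kappa$ on $J(k,\omega)_{i,j}$, for all $k,i,j$. *)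

(* Defs.v *)
From HB Require Import structures.
From mathcomp Require Import all_boot all_order all_algebra.
From mathcomp Require Import generic_quotient ring_quotient ring lra.
From mathcomp Require Import all_classical all_reals all_analysis.
From mathcomp Require Import measurable_realfun ess_sup_inf.

Set Implicit Arguments.
Unset Strict Implicit.
Unset Printing Implicit Defensive.

Import Order.TTheory GRing.Theory Num.Theory.
Import numFieldNormedType.Exports.

Local Open Scope classical_set_scope.
Local Open Scope ring_scope.

Definition int_subgroup (R : realType) : zmodClosed R :=
  GRing.ZmodClosed.clone R (@Num.int_num_subdef R) _.

Definition circle (R : realType) : Type := Quotient.quot (int_subgroup R).

HB.instance Definition _ (R : realType) := GRing.Zmodule.on (circle R).
HB.instance Definition _ (R : realType) := isPointed.Build (circle R) 0.

Section Circle.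
Context {R : realType}.
Implicit Types (x y z : circle R) (r : R).

Definition cproj r : circle R := (\pi_(Quotient.quot (int_subgroup R)) r)%qT.

(* The representative of z in [-1/2, 1/2[; its absolute value is the arc-length
   distance from z to 0. *)
Definition clift z : R :=
  let r : R := repr (z : Quotient.quot (int_subgroup R)) in
  r - (Num.floor (r + 2^-1))%:~R.

Definition cdist x y : R := `|clift (x - y)|.

Lemma cprojB : {morph cproj : x y / x - y}.
Proof. by move=> x y; rewrite /cproj raddfB. Qed.

Lemma cproj0 : cproj 0 = 0.
Proof. by rewrite /cproj raddf0. Qed.

Lemma cprojD : {morph cproj : x y / x + y}.
Proof. by move=> x y; rewrite /cproj raddfD. Qed.

Lemma cproj_int (m : int) : cproj m%:~R = 0.
Proof.
rewrite -cproj0; apply/eqP; rewrite /cproj -Quotient.idealrBE subr0.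
exact: intr_int.
Qed.

Lemma cliftK : cancel clift cproj.
Proof. by move=> z; rewrite cprojB cproj_int subr0 /cproj reprK. Qed.

Lemma clift_ge z : - 2^-1 <= clift z.
Proof.
rewrite /clift; set r := repr _.
have := floor_le (r + 2^-1); lra.
Qed.

Lemma clift_lt z : clift z < 2^-1.
Proof.
rewrite /clift; set r := repr _.
have := floorD1_gt (r + 2^-1); rewrite intrD; lra.
Qed.

Lemma cproj_eq0 r : cproj r = 0 -> exists m : int, r = m%:~R.
Proof.
rewrite -cproj0 => /eqP; rewrite /cproj -Quotient.idealrBE subr0.
by move=> /intrP.
Qed.

Lemma norm_clift_le r : `|clift (cproj r)| <= `|r|.
Proof.
have [m rm] : exists m : int, r - clift (cproj r) = m%:~R.
  by apply: cproj_eq0; rewrite cprojB cliftK subrr.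
have [m0|m0] := eqVneq m 0.
  by move: rm; rewrite m0 => /subr0_eq <-.
have m1 : (1 : R) <= `|m%:~R| by rewrite -intr_norm ler1z -gtz0_ge1 normr_gt0.
have := clift_ge (cproj r); have := clift_lt (cproj r).
set c := clift _ in rm *; rewrite -rm in m1.
have := ler_normB r c => h c1 c2.
have c3 : `|c| <= 2^-1 by rewrite ler_norml c2 ltW.
lra.
Qed.

Lemma cdistxx x : cdist x x = 0.
Proof.
have := norm_clift_le 0; rewrite normr0 normr_le0 cproj0 => /eqP clift0.
by rewrite /cdist subrr clift0 normr0.
Qed.

Lemma cdist_positivity x y : cdist x y = 0 -> x = y.
Proof.
move/normr0_eq0 => h; apply/subr0_eq.
by rewrite -[LHS]cliftK h cproj0.
Qed.

Lemma cdist_sym x y : cdist x y = cdist y x.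
Proof.
have H u v : cdist u v <= cdist v u.
  rewrite /cdist -[u - v]opprB -[X in - X]cliftK -sub0r -cproj0 -cprojB.
  by rewrite (le_trans (norm_clift_le _)) // sub0r normrN.
by apply/eqP; rewrite eq_le !H.
Qed.

Lemma cdist_triangle y x z : cdist x z <= cdist x y + cdist y z.
Proof.
rewrite /cdist -(subrKA y) -[x - y in leLHS]cliftK -[y - z in leLHS]cliftK.
by rewrite -cprojD (le_trans (norm_clift_le _)) // ler_normD.
Qed.

Lemma cdist_cproj r s : cdist (cproj r) (cproj s) <= `|r - s|.
Proof. by rewrite /cdist -cprojB norm_clift_le. Qed.

End Circle.

HB.instance Definition _ (R : realType) := @isMetric.Build R (circle R)
  cdist cdistxx cdist_positivity cdist_sym cdist_triangle.

Section CircleMeasure.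
Context {R : realType}.

Let borel : set (set (circle R)) := <<s @open (circle R) >>.

Let borel0 : borel set0. Proof. exact: sigma_algebra0. Qed.

Let borelC A : borel A -> borel (~` A). Proof. exact: sigma_algebraC. Qed.

Let borel_bigcup (F : (set (circle R))^nat) :
  (forall i, borel (F i)) -> borel (\bigcup_i F i).
Proof. exact: sigma_algebra_bigcup. Qed.

HB.instance Definition _ := @isMeasurable.Build (sigma_display (@open (circle R)))
  (circle R) borel borel0 borelC borel_bigcup.

Lemma cproj_continuous : continuous (@cproj R).
Proof.
move=> r; apply/metricType_numDomainType.cvgrPdist_lt => e e0.
near=> s; apply: le_lt_trans (cdist_cproj r s) _.
by near: s; exact: (@cvgr_dist_lt _ _ _ _ _ id).
Unshelve. all: by end_near. Qed.

Lemma measurable_cproj : measurable_fun setT (@cproj R).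
Proof.
apply: (measurability (@open (circle R))) => // _ [A oA <-].
rewrite setTI; apply: open_measurable.
by move/continuousP: cproj_continuous; apply.
Qed.

Let measurable_cproj_preimage A : measurable A -> measurable (cproj @^-1` A).
Proof. by move=> mA; rewrite -[X in measurable X]setTI; exact: measurable_cproj. Qed.

Definition circle_leb (A : set (circle R)) : \bar R :=
  lebesgue_measure (`[0%R, 1%R[ `&` cproj @^-1` A).

Let circle_leb0 : circle_leb set0 = 0%E.
Proof. by rewrite /circle_leb preimage_set0 setI0 measure0. Qed.

Let circle_leb_ge0 A : (0 <= circle_leb A)%E.
Proof. exact: measure_ge0. Qed.

Let circle_leb_sigma_additive : semi_sigma_additive circle_leb.
Proof.
move=> F mF tF mUF; rewrite /circle_leb preimage_bigcup setI_bigcupr.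
apply: measure_semi_sigma_additive.
- by move=> n; apply: measurableI => //; exact: measurable_cproj_preimage.
- apply: trivIset_setIl; apply/trivIsetP => /= i j _ _ ij.
  rewrite -preimage_setI.
  by move/trivIsetP : tF => /(_ _ _ _ _ ij) ->//; rewrite preimage_set0.
- rewrite -setI_bigcupr -preimage_bigcup.
  by apply: measurableI => //; exact: measurable_cproj_preimage.
Qed.

HB.instance Definition _ := isMeasure.Build _ _ _ circle_leb
  circle_leb0 circle_leb_ge0 circle_leb_sigma_additive.

Let circle_leb_setT : circle_leb setT = 1%E.
Proof.
rewrite /circle_leb preimage_setT setIT lebesgue_measure_itv /= lte_fin ltr01.
by rewrite sube0.
Qed.

HB.instance Definition _ :=
  Measure_isProbability.Build _ _ _ circle_leb circle_leb_setT.

End CircleMeasure.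

Section CircleMaps.
Context {R : realType}.
Implicit Types (x y : circle R) (A I : set (circle R)).

Definition circle_interval I := connected I /\ I° !=set0.

(* The value 1 at the empty set makes the conditions below meaningful for maps
   without singularities. *)
Definition dist_to x A : R :=
  if `[< A = set0 >] then 1 else inf [set mdist x a | a in A].

Definition dist_trunc (delta : R) x A : R :=
  if delta < dist_to x A then 1 else dist_to x A.

Implicit Type g : circle R -> circle R.

(* The local lift of g at x, mapping 0 to 0. *)
Definition local_lift g x (t : R) : R := clift (g (x + cproj t) - g x).

Definition differentiable_at g x : Prop := derivable (local_lift g x) 0 1.

Definition nondiff_set g : set (circle R) := [set x | ~ differentiable_at g x].

(* Set to 0 by convention on the set of non-differentiability points. *)
Definition dmap g x : R :=
  if `[< differentiable_at g x >] then derive1 (local_lift g x) 0 else 0.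

Definition d2map g x : R := derive1 (fun t => dmap g (x + cproj t)) 0.

Definition critical_set g : set (circle R) :=
  [set x | differentiable_at g x /\ dmap g x = 0].

Definition singular_set g := nondiff_set g `|` critical_set g.

Definition piecewise_C2 g : Prop :=
  finite_set (nondiff_set g) /\
  forall x, ~ nondiff_set g x ->
    derivable (fun t => dmap g (x + cproj t)) 0 1 /\
    {for x, continuous (d2map g)}.

Definition bounded_derivatives g : Prop :=
  exists M : R, forall x, ~ nondiff_set g x ->
    `|dmap g x| <= M /\ `|d2map g x| <= M.

(* g takes values in a compact set, so only the derivatives matter. *)
Definition C2_norm g : \bar R :=
  ereal_sup [set (Num.max `|dmap g x| `|d2map g x|)%:E |
             x in ~` nondiff_set g].

(* The value is -oo at critical and at non-differentiability points. *)
Definition log_dmap g x : \bar R := lne `|dmap g x|%:E.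

Definition regular_singular_set g (B beta : R) : Prop :=
  (forall x, ~ singular_set g x ->
     B^-1 * dist_to x (singular_set g) `^ beta <= `|dmap g x|) /\
  (forall x y, ~ singular_set g x -> ~ singular_set g y ->
     mdist x y <= dist_to x (singular_set g) / 2 ->
     `|ln `|dmap g x| - ln `|dmap g y| | <=
       B * (mdist x y / dist_to x (singular_set g) `^ beta)).

Definition expands_on g (kappa : R) A : Prop :=
  forall x, A x -> differentiable_at g x /\ kappa < `|dmap g x|.

End CircleMaps.

Definition paths (X : Type) : Type := nat -> X.

Definition paths_display : measure_display -> measure_display.
Proof. exact. Qed.

Section Paths.
Context d (X : measurableType d).

HB.instance Definition _ := Pointed.copy (paths X) (nat -> X).

Let cylinders : set (set (paths X)) :=
  <<s \bigcup_i preimage_set_system setT (fun w : paths X => w i) measurable >>.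

Let cylinders0 : cylinders set0. Proof. exact: sigma_algebra0. Qed.

Let cylindersC A : cylinders A -> cylinders (~` A).
Proof. exact: sigma_algebraC. Qed.

Let cylinders_bigcup (F : (set (paths X))^nat) :
  (forall i, cylinders (F i)) -> cylinders (\bigcup_i F i).
Proof. exact: sigma_algebra_bigcup. Qed.

HB.instance Definition _ := @isMeasurable.Build (paths_display d)
  (paths X) cylinders cylinders0 cylindersC cylinders_bigcup.

Definition path_shift (w : paths X) : paths X := fun n => w n.+1.

(* This determines P, as the cylinders form a pi-system generating the
   sigma-algebra. *)
Definition is_product_measure (R : realType) (nu : probability X R)
    (P : probability (paths X) R) : Prop :=
  forall (n : nat) (A : nat -> set X), (forall i, measurable (A i)) ->
    P [set w | forall i, (i < n)%N -> A i (w i)] = (\prod_(i < n) nu (A i))%E.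

End Paths.

(* Probabilities of events that are not assumed to be measurable: upper bounds
   are on the outer probability, lower bounds on the inner one. Both agree with
   P on measurable events. *)
Definition outer_prob d (T : measurableType d) (R : realType)
    (P : probability T R) (A : set T) : \bar R :=
  ereal_inf [set P B | B in [set B | measurable B /\ A `<=` B]].

Definition inner_prob d (T : measurableType d) (R : realType)
    (P : probability T R) (A : set T) : \bar R :=
  ereal_sup [set P B | B in [set B | measurable B /\ B `<=` A]].

Definition ergodic d (T : measurableType d) (R : realType)
    (m : set T -> \bar R) (F : T -> T) : Prop :=
  (forall A, measurable A -> m (F @^-1` A) = m A) /\
  (forall A, measurable A -> F @^-1` A = A -> m A = 0%E \/ m A = 1%E).

Section RandomCircleMaps.
Context (R : realType) d (X : measurableType d).
Variables (P : probability (paths X) R) (g : paths X -> circle R -> circle R).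

Fixpoint cocycle (n : nat) (w : paths X) (x : circle R) : circle R :=
  if n is m.+1 then g (iter m (@path_shift d X) w) (cocycle m w x) else x.

Definition standing : Prop :=
  forall w, [/\ continuous (g w), piecewise_C2 (g w) &
                bounded_derivatives (g w)].

Definition as_regular : Prop :=
  exists B beta : R, [/\ 1 < B, 0 < beta &
    {ae P, forall w, regular_singular_set (g w) B beta}].

Definition H0 : Prop :=
  [/\ forall w w' : paths X, w 0%N = w' 0%N -> g w = g w',
      forall x, measurable_fun setT (fun w => g w x),
      {ae P, forall w, continuous (g w) /\ piecewise_C2 (g w)},
      as_regular &
      (ess_sup P (fun w => C2_norm (g w)) < +oo)%E].

Definition stationary (mu : probability (circle R) R) : Prop :=
  forall A, measurable A -> mu A = (\int[mu]_x P [set w | A (g w x)])%E.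

Definition skew_product (p : paths X * circle R) : paths X * circle R :=
  (path_shift p.1, g p.1 p.2).

Definition ergodic_stationary (mu : probability (circle R) R) : Prop :=
  stationary mu /\ ergodic (P \x mu)%E skew_product.

Definition H1 : Prop :=
  exists mu : probability (circle R) R,
    [/\ ergodic_stationary mu,
        forall mu' : probability (circle R) R, ergodic_stationary mu' ->
          forall A, measurable A -> mu' A = mu A,
        mu `<< circle_leb /\ circle_leb `<< mu &
        (P \x mu)%E.-integrable setT
          (fun p : paths X * circle R => log_dmap (g p.1) p.2)].

Definition expansion_sum (n : nat) (w : paths X) (x : circle R) : \bar R :=
  (\sum_(i < n) log_dmap (g (iter i (@path_shift d X) w)) (cocycle i w x))%E.

Definition H2 : Prop :=
  exists lambda alpha1 C1 : R, [/\ 0 < lambda, 0 < alpha1, 1 <= C1 &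
    {ae circle_leb, forall x, forall n, (1 <= n)%N ->
      (outer_prob P [set w | (expansion_sum n w x < (lambda * n%:R)%:E)%E] <=
       (C1 * n%:R `^ (- (4 + alpha1)))%:E)%E}].

Definition recurrence_sum (n : nat) (w : paths X) (x : circle R) (delta : R) : \bar R :=
  (\sum_(j < n) - lne (dist_trunc delta (cocycle j w x)
                        (singular_set (g (iter j (@path_shift d X) w))))%:E)%E.

Definition H3 : Prop :=
  exists (H : R -> R) (alpha2 C2 : R),
    [/\ H delta @[delta --> 0^'+] --> (0 : R), 1 < alpha2, 1 <= C2 &
    exists2 delta0 : R, 0 < delta0 &
    {ae circle_leb, forall x, forall delta, 0 < delta < delta0 ->
      forall n, (1 <= n)%N ->
      (outer_prob P [set w | ((H delta * n%:R)%:E < recurrence_sum n w x delta)%E] <=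
       (C2 * n%:R `^ (- (4 + alpha2)))%:E)%E}].

Definition full_branch_expanding (w : paths X) (kappa0 : R) (K : nat)
    (I : set (circle R)) : Prop :=
  exists (J : set (circle R)) (i : nat),
    [/\ J `<=` I, (i <= K)%N, cocycle i w @` J = setT &
        expands_on (cocycle i w) kappa0 J].

Definition H4 : Prop :=
  exists2 kappa0 : R, 1 < kappa0 &
  exists2 eta0 : R, 0 < eta0 &
  forall eta : R, 0 < eta < eta0 ->
  exists (K : nat) (iota : R), 0 < iota < 1 /\
  forall I, circle_interval I ->
    ((eta / 4)%:E <= circle_leb I <= (4 * eta)%:E)%E ->
    (iota%:E < inner_prob P [set w | full_branch_expanding w kappa0 K I])%E.

(* The constant c is a lower bound of the infimum of |dg_w| over I_w and w. *)
Definition H5 : Prop :=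
  exists2 c : R, 1 < c &
  {ae P, forall w, exists I, [/\ circle_interval I, g w @` I = setT &
    forall x, I x -> differentiable_at (g w) x /\ c <= `|dmap (g w) x|]}.

Definition horseshoe_times (I0 I1 : set (circle R)) (w : paths X) (kappa : R)
    (n : nat -> nat) : Prop :=
  let I (b : bool) := if b then I1 else I0 in
  [/\ {homo n : k l / (k < l)%N},
      (limn_esup (fun k => ((n k)%:R / k%:R)%:E : \bar R) < +oo)%E &
      exists J : nat -> bool -> bool -> set (circle R), forall k i j,
        let h := cocycle (n k.+1 - n k) (iter (n k) (@path_shift d X) w) in
        [/\ J k i j `<=` I i, h @` J k i j = I j & expands_on h kappa (J k i j)]].

Definition horseshoe (I0 I1 : set (circle R)) (w : paths X) (kappa : R) : Prop :=
  exists n : nat -> nat, horseshoe_times I0 I1 w kappa n.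

End RandomCircleMaps.

(* Main.v *)
(** Full branches are permanent: by (H5) almost every map has an expanding branch
    onto the circle, so once an arc has a full branch at some time it has one, with
    larger and larger derivative, at all later times.  It is therefore enough to find,
    for two given arcs, an event of positive probability that depends on finitely many
    coordinates and on which both arcs have a full branch by a fixed time [N].

    For the first arc (H4) provides such an event [D].  During the time it takes, the
    second arc is tracked: by (H1) the derivative is almost surely nonzero at almost
    every point, so a random map sends some subarc diffeomorphically onto an arc with
    rational data, and for one choice of these data this happens with positive
    probability together with [D].  The tracked arc then gets a full branch by (H4)
    and the independence of the later coordinates; a few more steps compensate for the
    derivative that was lost while tracking.

    Cut time into blocks of length [N].  The visits of the blocks to this event are
    independent, so the return times [n_k], read off from the [k]-th visited block
    after block [0], satisfy [n_k / k -> N / p] by the law of large numbers, where [p]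
    is the probability of the event; and [N / p] is the mean of [n_0], since the index
    of the first visited block is geometric.  Every interval contains an arc with
    rational endpoints, so a single null set serves all pairs of intervals. *)

Require Import Defs.
From mathcomp Require Import all_boot all_order all_algebra.
From mathcomp Require Import ring lra zify.
From mathcomp Require Import all_classical all_reals all_analysis.
From mathcomp Require Import measurable_realfun.

Import Order.TTheory GRing.Theory Num.Theory.
Import numFieldNormedType.Exports.

Local Open Scope classical_set_scope.
Local Open Scope ring_scope.

(** * Product measures on paths *)

Section ProductPaths.
Context {R : realType} {d : measure_display} {X : measurableType d}.
Implicit Types (A B D : set (paths X)) (w : paths X).

Lemma measurable_coord (i : nat) : measurable_fun setT (fun w : paths X => w i).
Proof.
move=> _ A mA; apply: sub_sigma_algebra; exists i => //; exists A => //.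
Qed.

Lemma measurable_to_paths d' (T : measurableType d') (f : T -> paths X) :
  (forall i, measurable_fun setT (fun t => f t i)) -> measurable_fun setT f.
Proof.
move=> mf.
apply: (measurability (\bigcup_i preimage_set_system setT
  (fun w : paths X => w i) measurable)) => //.
move=> _ [_ [i _ [A mA <-]] <-]; rewrite !setTI.
by rewrite -[X in measurable X]setTI; exact: mf.
Qed.

Lemma iter_shiftE (n : nat) w : iter n (@path_shift d X) w = fun i => w (n + i)%N.
Proof.
elim: n => [|n IHn] /=; first by apply/funext => i.
by rewrite IHn /path_shift; apply/funext => i; rewrite addnS.
Qed.

Lemma measurable_iter_shift (n : nat) :
  measurable_fun setT (iter n (@path_shift d X)).
Proof.
apply: measurable_to_paths => i.
by rewrite (_ : (fun _ => _) = (fun w : paths X => w (n + i)%N));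
  [exact: measurable_coord|apply/funext => w; rewrite iter_shiftE].
Qed.

Lemma measurable_shift_preimage (n : nat) A : measurable A ->
  measurable (iter n (@path_shift d X) @^-1` A).
Proof.
by move=> mA; rewrite -[X in measurable X]setTI; exact: measurable_iter_shift.
Qed.

(** Splicing two independent paths at time [n] again gives a path of law [P] ([splice_measure]);
    this form of the independence of past and future turns product events into rectangles. *)
Definition splice (n : nat) (p : paths X * paths X) : paths X :=
  fun i => if (i < n)%N then p.1 i else p.2 (i - n)%N.

Lemma measurable_splice n : measurable_fun setT (splice n).
Proof.
apply: measurable_to_paths => i; rewrite /splice; case: (i < n)%N.
  by apply: (measurableT_comp (measurable_coord i)); exact: measurable_fst.
by apply: (measurableT_comp (measurable_coord _)); exact: measurable_snd.
Qed.

Lemma shift_splice n p : iter n (@path_shift d X) (splice n p) = p.2.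
Proof.
rewrite iter_shiftE; apply/funext => i.
by rewrite /splice ltnNge leq_addr /= addKn.
Qed.

(** Dependence on the first [n] coordinates is stated pointwise rather than through a
    sub-sigma-algebra, so that it also applies to events not known to be measurable, such as the one
    in (H4). *)
Definition determined (n : nat) A :=
  forall w w', (forall i, (i < n)%N -> w i = w' i) -> A w -> A w'.

Lemma determined_splice n A p : determined n A -> A (splice n p) = A p.1.
Proof.
move=> dA; apply/propext; split; apply: dA => i /= ni;
  by rewrite /splice ni.
Qed.

Lemma determined_le m n A : (m <= n)%N -> determined m A -> determined n A.
Proof. by move=> mn dA w w' ww'; apply: dA => i im; apply/ww'/(leq_trans im). Qed.

Lemma determinedI n A B : determined n A -> determined n B -> determined n (A `&` B).
Proof. by move=> dA dB w w' ww' [Aw Bw]; split; [exact: dA Aw|exact: dB Bw]. Qed.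

Lemma determinedC n A : determined n A -> determined n (~` A).
Proof. by move=> dA w w' ww' nAw Aw'; apply/nAw/(dA _ _ _ Aw') => i /ww' ->. Qed.

Lemma determined_shift m n A : determined n A ->
  determined (m + n) (iter m (@path_shift d X) @^-1` A).
Proof.
move=> dA w w' ww' /=; rewrite !iter_shiftE; apply: dA => i ni.
by apply: ww'; rewrite ltn_add2l.
Qed.

Context {nu : probability X R} {P : probability (paths X) R}.
Hypothesis hP : is_product_measure nu P.

Let boxes : set (set (paths X)) :=
  [set E | exists (n : nat) (A : nat -> set X), (forall i, measurable (A i)) /\
     E = [set w | forall i, (i < n)%N -> A i (w i)]].

Let measurable_box n (A : nat -> set X) : (forall i, measurable (A i)) ->
  measurable [set w : paths X | forall i, (i < n)%N -> A i (w i)].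
Proof.
move=> mA.
rewrite (_ : mkset _ = \bigcap_(i in [set i | (i < n)%N])
  ((fun w : paths X => w i) @^-1` A i)) //.
apply: bigcap_measurableType => i _.
by rewrite -[X in measurable X]setTI; apply: measurable_coord.
Qed.

Let measurable_boxesE : measurable = <<s boxes >>.
Proof.
apply/seteqP; split.
  apply: smallest_sub; first exact: smallest_sigma_algebra.
  move=> _ [i _ [A mA <-]]; rewrite setTI; apply: sub_sigma_algebra.
  exists i.+1, (fun j => if j == i then A else setT); split.
    by move=> j; case: ifP.
  apply/seteqP; split => w /=.
    by move=> Awi j _; case: eqP => // ->.
  by move=> /(_ i (ltnSn i)); rewrite eqxx.
apply: smallest_sub.
  exact: sigma_algebra_measurable.
by move=> _ [n [A [mA ->]]]; exact: measurable_box.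
Qed.

Let boxesI : setI_closed boxes.
Proof.
move=> _ _ [n [A [mA ->]]] [m [B [mB ->]]].
exists (maxn n m), (fun i => (if (i < n)%N then A i else setT) `&`
                             (if (i < m)%N then B i else setT)); split.
  by move=> i; apply: measurableI; case: ifP.
apply/seteqP; split => w /=.
  by move=> [Aw Bw] i _; split; case: ifP => // h; [exact: Aw|exact: Bw].
move=> h; split => i hi.
  by have := h i; rewrite hi leq_max hi /= => /(_ isT)[].
by have := h i; rewrite hi leq_max hi orbT /= => /(_ isT)[].
Qed.

(** Both sides are finite measures. They agree on the finite boxes by the product formula for [P],
    and these boxes form a pi-system that generates the sigma-algebra. *)
Lemma splice_measure (n : nat) A : measurable A ->
  P A = (P \x P)%E (splice n @^-1` A).
Proof.
move=> mA; rewrite -/(pushforward (P \x P)%E (splice n) A).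
apply: (measure_unique boxes (fun=> setT)) => //.
- by move=> _; exists 0%N, (fun=> setT); split => //; apply/seteqP; split.
- by rewrite bigcup_const.
- exact: measurable_splice.
- move=> ? _ [m [A0 [mA0 ->]]]; rewrite /= /pushforward.
  (* Padding with [setT] turns the box into one of length [n + m], which can be cut at [n] whatever
     the order of [m] and [n]. *)
  pose A' i := if (i < m)%N then A0 i else setT.
  have mA' i : measurable (A' i) by rewrite /A'; case: ifP.
  have -> : [set w : paths X | forall i, (i < m)%N -> A0 i (w i)] =
      [set w | forall i, (i < n + m)%N -> A' i (w i)].
    apply/seteqP; split => w /= h i im.
      by rewrite /A'; case: ifP => // /h.
    by have := h i (ltn_addl _ im); rewrite /A' im.
  have -> : splice n @^-1` [set w | forall i, (i < n + m)%N -> A' i (w i)] =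
      [set w | forall i, (i < n)%N -> A' i (w i)] `*`
      [set w | forall i, (i < m)%N -> A' (n + i)%N (w i)].
    apply/seteqP; split => -[w w'] /=; rewrite /splice /=.
      move=> h; split => i im.
        by have := h i (ltn_addr _ im); rewrite im.
      have := h (n + i)%N; rewrite ltn_add2l => /(_ im).
      by rewrite ltnNge leq_addr /= addKn.
    move=> [h1 h2] i im; case: ifPn => [/h1//|]; rewrite -leqNgt => ni.
    have := h2 (i - n)%N; rewrite subnKC //; apply.
    by rewrite ltn_subLR.
  rewrite product_measure1E; last 2 first.
    exact: (measurable_box _ A').
    by apply: (measurable_box _ (fun i => A' (n + i)%N)).
  have hs := hP m (fun i => A' (n + i)%N) (fun i => mA' _).
  rewrite (hP _ A')// big_split_ord; congr (_ * _)%E.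
    exact/esym/(hP n A').
  exact/esym/hs.
- by move=> _; have := probability_setT P => /= ->; rewrite ltry.
Qed.

(** The preimage of the intersection under [splice n] is the rectangle [A] times [B]. *)
Lemma measure_determinedI (n : nat) A B : measurable A -> determined n A ->
  measurable B ->
  P (A `&` iter n (@path_shift d X) @^-1` B) = (P A * P B)%E.
Proof.
move=> mA dA mB; rewrite (splice_measure n); last first.
  by apply: measurableI => //; exact: measurable_shift_preimage.
rewrite -product_measure1E//; congr (_ _).
apply/seteqP; split => -[w w'] /=; rewrite shift_splice /=.
  by rewrite determined_splice.
by rewrite determined_splice.
Qed.

Lemma measure_shift (n : nat) B : measurable B ->
  P (iter n (@path_shift d X) @^-1` B) = P B.
Proof.
move=> mB; rewrite -[in LHS](setTI (_ @^-1` _)) measure_determinedI //.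
by rewrite probability_setT mul1e.
Qed.

(* Integrating out the coordinates beyond [n] turns a measurable subset into
   one that, like [A], only sees the first [n] coordinates. *)
Lemma determined_kernel (n : nat) A B : determined n A -> measurable B ->
  B `<=` A -> (0 < P B)%E ->
  exists C, [/\ measurable C, determined n C, C `<=` A & (0 < P C)%E].
Proof.
move=> dA mB BA PB.
have mS : measurable (splice n @^-1` B).
  by rewrite -[X in measurable X]setTI; exact: measurable_splice.
pose f (w : paths X) : \bar R := P (xsection (splice n @^-1` B) w).
have mf : measurable_fun setT f by exact: measurable_fun_xsection.
have splE w w' : (forall i, (i < n)%N -> w i = w' i) ->
    forall v, splice n (w, v) = splice n (w', v).
  by move=> h v; apply/funext => i; rewrite /splice /=; case: ifP => // /h.
(* Keep the beginnings of paths that have a non-negligible set of continuations in [B]. By Fubini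
   [P B] is the integral of [f], so this set cannot be null. *)
exists [set w | (0 < f w)%E]; split.
- by have := emeasurable_fun_o_infty measurableT mf 0%E; rewrite setTI.
- move=> w w' ww' /=; rewrite /f; congr (0 < P _)%E.
  by apply/seteqP; split => v; rewrite /xsection /= !inE /= (splE _ _ ww').
- move=> w /= fw; have [xs0|/set0P[v]] := eqVneq (xsection (splice n @^-1` B) w) set0.
    by move: fw; rewrite /f xs0 measure0 ltxx.
  rewrite /xsection /= inE /= => /BA; apply: dA => i ni; by rewrite /splice /= ni.
- have f0 w : (0 <= f w)%E by exact: measure_ge0.
  rewrite lt0e measure_ge0 andbT; apply/negP => /eqP C0.
  suff : P B = 0%E by move=> PB0; rewrite PB0 ltxx in PB.
  rewrite (splice_measure n) //= /product_measure1 /= -/f.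
  have := (ae_eq_integral_abs P measurableT mf).2.
  rewrite (eq_integral f) => [->//|w _]; last by rewrite gee0_abs.
  exists [set w | (0 < f w)%E]; split => //.
    by have := emeasurable_fun_o_infty measurableT mf 0%E; rewrite setTI.
  move=> w /= /not_implyP[_ /eqP fw]; by rewrite lt0e fw f0.
Qed.

End ProductPaths.

(** * A law of large numbers for pairwise independent events *)

Lemma nat_sqrt_exists (n : nat) : exists k, (k ^ 2 <= n < k.+1 ^ 2)%N.
Proof.
elim: n => [|n [k /andP[kn nk]]]; first by exists 0%N.
have [h|h] := ltnP n.+1 (k.+1 ^ 2)%N; [exists k|exists k.+1]; lia.
Qed.

(** For [n] between [k ^ 2] and [k.+1 ^ 2] the value of [v] differs from that at [k ^ 2] by at most
    [2 * k], which is negligible against [k ^ 2]. *)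
Lemma cvg_mean_of_squares {R : realType} (v : nat -> R) :
  (forall m n, (m <= n)%N -> `|v n - v m| <= (n - m)%:R) ->
  (v (k ^ 2)%N / k%:R ^+ 2) @[k --> \oo] --> 0 ->
  (v n / n%:R) @[n --> \oo] --> 0.
Proof.
move=> vlip /cvgrPdist_le vsq; apply/cvgrPdist_le => e e0.
have [|K0 _ hK0] := vsq (e / 2); first by rewrite divr_gt0.
(* From [k >= 4 / e] on, the error [2 * k] is at most half of [e * k ^ 2]; the other half is left
   for the value at the square. *)
pose K := maxn K0 (Num.truncn (4 / e)).+1.
exists (K ^ 2)%N => // n /= Kn.
have [k /andP[kn nk]] := nat_sqrt_exists n.
have Kk : (K <= k)%N by rewrite -ltnS -ltn_sqr (leq_ltn_trans Kn).
have K0k : (K0 <= k)%N by apply: leq_trans Kk; rewrite leq_maxl.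
have k4 : 4 / e <= k%:R.
  apply: (le_trans (ltW (truncnS_gt _))); rewrite ler_nat.
  by apply: leq_trans Kk; rewrite leq_maxr.
have k0 : (0 < k)%N by apply: leq_trans Kk; rewrite /K leq_max ltn0Sn orbT.
have kR : 0 < k%:R :> R by rewrite ltr0n.
have n0 : 0 < n%:R :> R by rewrite ltr0n; nia.
have := hK0 k K0k; rewrite !sub0r !normrN !normrM !normfV.
rewrite [`|k%:R ^+ 2|]ger0_norm ?sqr_ge0 // (gtr0_norm n0).
rewrite !ler_pdivrMr ?exprn_gt0 // => vk.
have vn := vlip _ _ kn.
have kn' : (n - k ^ 2)%:R <= 2 * k%:R :> R.
  by rewrite -natrM ler_nat; lia.
have knR : k%:R ^+ 2 <= n%:R :> R by rewrite -natrX ler_nat.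
have ek : 2 * k%:R <= e / 2 * k%:R ^+ 2.
  rewrite expr2 mulrA ler_wpM2r // ?(ltW kR) //.
  have k4e : 4 <= k%:R * e by rewrite -ler_pdivrMr.
  lra.
have := ler_normD (v n - v (k ^ 2)%N) (v (k ^ 2)%N); rewrite subrK => h.
apply: (le_trans h); apply: (le_trans (lerD vn vk)).
nra.
Qed.

Section LawOfLargeNumbers.
Context {R : realType} {d : measure_display} {T : measurableType d}.
Variables (P : probability T R) (E : nat -> set T) (p : R).
Hypotheses (mE : forall i, measurable (E i)) (PE : forall i, P (E i) = p%:E)
  (PEE : forall i j, i != j -> P (E i `&` E j) = (p * p)%:E).

Let N (n : nat) (w : T) : R := \sum_(i < n) \1_(E i) w.

Let mind i : measurable_fun setT (\1_(E i) : T -> R).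
Proof. exact: measurable_indic. Qed.

Let mN n : measurable_fun setT (N n).
Proof. by apply: measurable_sum => i. Qed.

Let N_ge0 n w : 0 <= N n w.
Proof. by apply: sumr_ge0 => i _; rewrite indicE. Qed.

Let integral_N n : (\int[P]_w (N n w)%:E = (n%:R * p)%:E)%E.
Proof.
under eq_integral do rewrite /N -sumEFin.
rewrite (ge0_integral_sum P measurableT); last 2 first.
- by move=> i; exact/measurable_EFinP.
- by move=> i w _; rewrite lee_fin indicE.
rewrite (eq_bigr (fun=> p%:E)) => [|i _]; last by rewrite integral_indic // setIT; exact: PE.
by rewrite sumEFin sumr_const card_ord mulr_natl.
Qed.

Let integral_NN n : (\int[P]_w (N n w ^+ 2)%:E =
  (n%:R * p + (n%:R ^+ 2 - n%:R) * p ^+ 2)%:E)%E.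
Proof.
have NNE w : ((N n w ^+ 2)%:E = \sum_(i < n) \sum_(j < n) (\1_(E i `&` E j) w)%:E :> \bar R)%E.
  rewrite expr2 /N mulr_suml -sumEFin; apply: eq_bigr => i _.
  rewrite mulr_sumr -sumEFin; apply: eq_bigr => j _.
  by rewrite indicI.
under eq_integral do rewrite NNE.
rewrite (ge0_integral_sum P measurableT); last 2 first.
- move=> i; apply: emeasurable_sum => j; apply/measurable_EFinP.
  by apply: measurable_indic; exact: measurableI.
- by move=> i w _; apply: sume_ge0 => j _; rewrite lee_fin indicE.
rewrite (eq_bigr (fun i : 'I_n => (p + (n%:R - 1) * p ^+ 2)%:E)); last first.
  move=> i _; rewrite (ge0_integral_sum P measurableT); last 2 first.
  - move=> j; apply/measurable_EFinP.
    by apply: measurable_indic; exact: measurableI.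
  - by move=> j w _; rewrite lee_fin indicE.
  (* The diagonal term contributes [p], and each of the [n - 1] others [p * p] by pairwise
     independence. *)
  rewrite (bigD1 i) //= integral_indic ?setIT ?setIid //.
  rewrite [X in (X + _)%E = _](PE i).
  rewrite (eq_bigr (fun=> (p * p)%:E)); last first.
    move=> j ji; rewrite integral_indic ?setIT //; last exact: measurableI.
    by apply: PEE; rewrite eq_sym.
  rewrite sumEFin sumr_const cardC1 card_ord -EFinD; congr (_ + _)%:E.
  case: n i {NNE} => [[]//|n] i; rewrite /= expr2.
  have -> : (n.+1%:R : R) = n%:R + 1 by rewrite natr1.
  by rewrite addrK mulr_natl.
rewrite sumEFin sumr_const card_ord -mulr_natl; congr (_%:E); ring.
Qed.

Let variance_N n : (\int[P]_w ((N n w - n%:R * p) ^+ 2)%:E <= n%:R%:E)%E.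
Proof.
have p01 : 0 <= p <= 1.
  by rewrite -!lee_fin -(PE 0%N) measure_ge0 probability_le1.
have mv : measurable_fun setT (fun w => ((N n w - n%:R * p) ^+ 2)%:E).
  by apply/measurable_EFinP; apply: measurable_funX; exact: measurable_funB.
have np0 : 0 <= n%:R * p by rewrite mulr_ge0 //; case/andP: p01.
(* The cross term is moved to the left, so that all integrands are nonnegative and additivity of the
   integral applies directly. *)
have : (\int[P]_w (((N n w - n%:R * p) ^+ 2)%:E + (2 * (n%:R * p))%:E * (N n w)%:E) =
  \int[P]_w ((N n w ^+ 2)%:E + (cst ((n%:R * p) ^+ 2)%:E w)))%E.
  by apply: eq_integral => w _; rewrite -EFinM -!EFinD; congr (_%:E); ring.
have mNE : measurable_fun setT (fun w => (N n w)%:E) by exact/measurable_EFinP.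
have mNN : measurable_fun setT (fun w => (N n w ^+ 2)%:E).
  by apply/measurable_EFinP; exact: measurable_funX.
rewrite (ge0_integralD P measurableT _ mv); last 3 first.
- by move=> w _; rewrite lee_fin sqr_ge0.
- by move=> w _; rewrite -EFinM lee_fin mulr_ge0 // mulr_ge0.
- by apply: emeasurable_funM => //; exact: measurable_cst.
rewrite (ge0_integralD P measurableT _ mNN); last 3 first.
- by move=> w _; rewrite lee_fin sqr_ge0.
- by move=> w _; rewrite lee_fin sqr_ge0.
- exact: measurable_cst.
rewrite (ge0_integralZl P measurableT mNE); last 2 first.
- by move=> w _; rewrite lee_fin.
- by rewrite lee_fin mulr_ge0.
rewrite integral_N integral_NN integral_cst //.
rewrite [X in _ = (_ + _ * X)%E](probability_setT P) mule1.
set V := (\int[P]_w _)%E.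
have V0 : (0 <= V)%E by apply: integral_ge0 => w _; rewrite lee_fin sqr_ge0.
case: V V0 => // v; rewrite lee_fin => v0 /=.
rewrite -!EFinM -!EFinD => -[] h; rewrite lee_fin.
have -> : v = n%:R * (p * (1 - p)) by move: h; rewrite !expr2; lra.
rewrite ler_piMr //; nra.
Qed.

(** The variance of the count is at most linear, so along the squares the expected squared
    deviations of the frequency are summable. Hence these deviations tend to 0 almost surely along
    squares, and [cvg_mean_of_squares] fills the gaps. *)
Lemma frequency_cvg :
  {ae P, forall w, (\sum_(i < n) \1_(E i) w) / n%:R @[n --> \oo] --> p}.
Proof.
have p01 : 0 <= p <= 1.
  by rewrite -!lee_fin -(PE 0%N) measure_ge0 probability_le1.
pose q k w : R := ((N (k.+1 ^ 2) w - (k.+1 ^ 2)%:R * p) / k.+1%:R ^+ 2) ^+ 2.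
have q0 k w : 0 <= q k w by exact: sqr_ge0.
have mq k : measurable_fun setT (fun w => (q k w)%:E).
  apply/measurable_EFinP; apply: measurable_funX; apply: measurable_funM => //.
  exact: measurable_funB.
have intq k : (\int[P]_w (q k w)%:E <= (k.+1%:R ^- 2)%:E)%E.
  under eq_integral do rewrite /q exprMn mulrC EFinM.
  rewrite (ge0_integralZl P measurableT); last 3 first.
  - apply/measurable_EFinP; apply: measurable_funX; exact: measurable_funB.
  - by move=> w _; rewrite lee_fin sqr_ge0.
  - by rewrite lee_fin sqr_ge0.
  apply: (@le_trans _ _ (((k.+1%:R ^- 2) ^+ 2)%:E * (k.+1 ^ 2)%:R%:E)%E).
    by apply: lee_wpmul2l; [rewrite lee_fin sqr_ge0|exact: variance_N].
  rewrite -EFinM lee_fin expr2 -mulrA natrX mulVf ?mulr1 //.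
(* The sum of inverse squares is compared with a telescoping sum. *)
have sumq n : \sum_(k < n.+1) (k.+1%:R ^- 2 : R) <= 2 - n.+1%:R^-1.
  elim: n => [|n IHn]; first by rewrite big_ord_recr big_ord0 /= !invr1 expr1n invr1; lra.
  rewrite big_ord_recr /=; apply: (le_trans (lerD IHn (lexx _))).
  have h1 : 0 < n.+1%:R :> R by rewrite ltr0n.
  have -> : (n.+2%:R : R) = n.+1%:R + 1 by rewrite natr1.
  move: h1; set x := n.+1%:R => x0.
  have x1 : 0 < x + 1 by lra.
  have -> : 2 - x^-1 + (x + 1) ^- 2 =
    2 - (x + 1)^-1 - x^-1 * ((x + 1)^-1) ^+ 2.
    by field; rewrite !gt_eqF.
  by rewrite gerBl mulr_ge0 ?sqr_ge0 // invr_ge0 ltW.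
have finq : (\int[P]_w (\sum_(k <oo) (q k w)%:E) <= 2%:E)%E.
  rewrite integral_nneseries //; last by move=> k w _; rewrite lee_fin.
  apply: lime_le.
    by apply: is_cvg_nneseries => k _ _; apply: integral_ge0 => w _; rewrite lee_fin.
  apply: nearW => n; apply: (@le_trans _ _ (\sum_(0 <= k < n) (k.+1%:R ^- 2)%:E)%E).
    by apply: lee_sum.
  rewrite sumEFin lee_fin big_mkord; case: n => [|n]; first by rewrite big_ord0.
  by apply: (le_trans (sumq n)); rewrite gerBl invr_ge0.
have intsum : P.-integrable setT (fun w => \sum_(k <oo) (q k w)%:E)%E.
  apply/integrableP; split.
    by apply: ge0_emeasurable_sum => // k w _ _; rewrite lee_fin.
  rewrite (eq_integral (fun w => \sum_(k <oo) (q k w)%:E)%E).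
    by apply: (le_lt_trans finq); rewrite ltry.
  by move=> w _; rewrite gee0_abs // nneseries_ge0 // => k _ _; rewrite lee_fin.
have := integrable_ae measurableT intsum.
apply: filterS => w /(_ I) fin.
suff : ((N n w - n%:R * p) / n%:R) @[n --> \oo] --> 0.
  move=> h; have : ((N n w - n%:R * p) / n%:R + p) @[n --> \oo] --> 0 + p.
    by apply: cvgD => //; exact: cvg_cst.
  rewrite add0r; apply: cvg_trans; apply: near_eq_cvg.
  exists 1%N => // n /= n1.
  by rewrite mulrBl mulrAC divff ?mul1r ?subrK // pnatr_eq0 -lt0n.
apply: (@cvg_mean_of_squares _ (fun n => N n w - n%:R * p)).
  move=> m n mn.
  have -> : N n w - n%:R * p - (N m w - m%:R * p) =
      \sum_(m <= i < n) (\1_(E i) w - p).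
    rewrite /N -!(big_mkord xpredT (fun i => \1_(E i) w)) (big_cat_nat _ mn) //=.
    by rewrite sumrB sumr_const_nat -(mulr_natl p) natrB //; ring.
  apply: (le_trans (ler_norm_sum _ _ _)).
  rewrite -[n in leRHS]subn0 -[X in _ <= X%:R]mul1n.
  apply: (@le_trans _ _ (\sum_(m <= i < n) 1)).
    apply: ler_sum => i _; rewrite indicE ler_norml.
    by case/andP: p01 => p0 p1; case: (_ \in _); rewrite /=; apply/andP; split; lra.
  by rewrite sumr_const_nat mul1n subn0.
rewrite -(cvg_shiftS (fun k => _)) /=.
have sq0 : (q k w) @[k --> \oo] --> 0.
  apply: cvg_series_cvg_0; apply: nondecreasing_is_cvgn.
    by apply: nondecreasing_series => k _ _.
  exists (fine (\sum_(k <oo) (q k w)%:E)%E) => _ [n _ <-].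
  rewrite -lee_fin fineK // /series /= -sumEFin.
  by apply: nneseries_lim_ge => k _ _; rewrite lee_fin.
apply/cvgrPdist_lt => e e0.
move/cvgrPdist_lt : sq0 => /(_ (e ^+ 2)) []; first by rewrite exprn_gt0.
move=> K _ hK; exists K => // k /= /hK /=; rewrite !sub0r !normrN /q normrX.
by rewrite ltr_pXn2r // ?nnegrE // ltW.
Qed.

End LawOfLargeNumbers.

(** * Visits of independent blocks *)

Section ReturnTimes.
Context {R : realType} {d : measure_display} {X : measurableType d}.
Variables (N : nat) (B : set (paths X)).
Implicit Types w : paths X.

Let E (i : nat) : set (paths X) := iter (N * i.+1) (@path_shift d X) @^-1` B.

(* The visits of the blocks 1, ..., n. Block 0 is left out so that the first
   visited block has mean index 1 / p. *)
Definition visits (n : nat) w : nat := \sum_(i < n) (w \in E i).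

Let visitsS n w : visits n.+1 w = (visits n w + (w \in E n))%N.
Proof. by rewrite /visits big_ord_recr. Qed.

Let visits_le m n w : (m <= n)%N -> (visits m w <= visits n w)%N.
Proof.
elim: n => [|n IHn]; first by rewrite leqn0 => /eqP ->.
rewrite leq_eqVlt => /predU1P[->//|/IHn h].
by rewrite visitsS (leq_trans h) ?leq_addr.
Qed.

Let visits_bound n w : (visits n w <= n)%N.
Proof.
elim: n => [|n IHn]; first by rewrite /visits big_ord0.
by rewrite visitsS; case: (_ \in _); lia.
Qed.

(* The value is 0 when fewer than k + 1 blocks are visited. *)
Definition visit_index (k : nat) w : nat :=
  if pselect (exists n, (k < visits n w)%N) is left h then ex_minn h else 0%N.

(** The count grows by at most one per block, so at the first index where it exceeds [k] it equals
    [k.+1]. The last clause says that index and count are inverse to each other; monotonicity,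
    measurability and the mean are read off from it. *)
Let visit_indexP k w : (exists n, (k < visits n w)%N) ->
  [/\ visits (visit_index k w) w = k.+1, (0 < visit_index k w)%N,
      B (iter (N * visit_index k w) (@path_shift d X) w) &
      forall n, (k < visits n w)%N = (visit_index k w <= n)%N].
Proof.
move=> ex; rewrite /visit_index; case: pselect => // h; case: ex_minnP => n kn nmin.
case: n kn nmin => [|n] kn nmin; first by move: kn; rewrite /visits big_ord0.
have nk : (visits n w <= k)%N.
  by rewrite leqNgt; apply/negP => /nmin; rewrite ltnn.
have En : w \in E n by move: kn; rewrite visitsS; case: (_ \in _); rewrite //= addn0; lia.
have vn : visits n.+1 w = k.+1 by move: kn; rewrite visitsS En /=; lia.
split => //; first by move: En; rewrite inE.
move=> m; apply/idP/idP => [/nmin//|nm].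
by apply: leq_trans kn _; exact: visits_le.
Qed.

Section Path.
Variable p : R.
Hypothesis p0 : 0 < p.
Variable w : paths X.
Hypothesis vw : (visits n w)%:R / n%:R @[n --> \oo] --> p.

Lemma visits_unbounded k : exists n, (k < visits n w)%N.
Proof.
apply: contrapT => nex.
have vk n : (visits n w <= k)%N.
  by rewrite leqNgt; apply/negP => h; apply: nex; exists n.
move/cvgrPdist_lt : vw => /(_ (p / 2)) []; first by rewrite divr_gt0.
move=> n0 _ h.
pose n := maxn n0 (Num.truncn (k%:R / (p / 2))).+1.
have := h n (leq_maxl _ _); rewrite /= ltr_norml => /andP[_].
have nk : k%:R / (p / 2) <= n%:R.
  by apply: (le_trans (ltW (truncnS_gt _))); rewrite ler_nat leq_maxr.
have nR : 0 < n%:R :> R by rewrite ltr0n /n; lia.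
rewrite ler_pdivrMr ?divr_gt0 // in nk.
have : (visits n w)%:R / n%:R <= p / 2.
  by rewrite ler_pdivrMr // mulrC; apply: le_trans nk; rewrite ler_nat.
lra.
Qed.

Lemma visit_index_hit k : B (iter (N * visit_index k w) (@path_shift d X) w).
Proof. by have [] := visit_indexP _ _ (visits_unbounded k). Qed.

Lemma visit_index_lt k l : (k < l)%N -> (visit_index k w < visit_index l w)%N.
Proof.
move=> kl; have [vk _ _ hk] := visit_indexP _ _ (visits_unbounded k).
have [vl _ _ hl] := visit_indexP _ _ (visits_unbounded l).
by rewrite ltnNge -hl vk ltnS -ltnNge.
Qed.

(** At the index of the [k]-th visit the frequency of visits is exactly [k.+1 / visit_index k w];
    this is inverted and then corrected by the factor [k.+1 / k]. *)
Lemma cvg_visit_index :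
  (visit_index k w)%:R / k%:R @[k --> \oo] --> p^-1.
Proof.
have tk k : (k < visit_index k w)%N.
  have [vk _ _ _] := visit_indexP _ _ (visits_unbounded k).
  by rewrite -[X in (X < _)%N]/k.+1.-1 -vk; have := visits_bound (visit_index k w) w; lia.
have idx_oo : visit_index k w @[k --> \oo] --> \oo.
  apply/cvgnyPge => A; exists A => // k /= Ak.
  by apply: leq_trans Ak (ltnW (tk k)).
have h1 := cvg_comp _ _ idx_oo vw.
have h2 : (k.+1%:R / (visit_index k w)%:R : R) @[k --> \oo] --> p.
  move: h1; apply: cvg_trans; apply: near_eq_cvg; apply: nearW => k /=.
  by have [-> _ _ _] := visit_indexP _ _ (visits_unbounded k).
have h3 : ((k.+1%:R / (visit_index k w)%:R : R)^-1) @[k --> \oo] --> p^-1.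
  by apply: cvgV => //; rewrite gt_eqF.
have h4 : (k.+1%:R / k%:R : R) @[k --> \oo] --> (1 : R).
  have h : ((1 : R) + (k%:R : R)^-1) @[k --> \oo] --> ((1 : R) + 0).
    apply: cvgD; first exact: cvg_cst.
    by rewrite -(cvg_shiftS (fun k => (k%:R : R)^-1)) /=; exact: cvg_harmonic.
  rewrite addr0 in h; move: h; apply: cvg_trans; apply: near_eq_cvg.
  exists 1%N => // k /= k1; rewrite -natr1 mulrDl divff ?div1r //.
  by rewrite pnatr_eq0 -lt0n.
have h5 : ((k.+1%:R / (visit_index k w)%:R : R)^-1 * (k.+1%:R / k%:R)) @[k --> \oo]
    --> p^-1 * 1 by exact: cvgM.
rewrite mulr1 in h5; move: h5; apply: cvg_trans; apply: near_eq_cvg.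
by apply: nearW => k /=; rewrite invf_div mulrA divfK // pnatr_eq0.
Qed.

End Path.

Hypothesis mB : measurable B.

Let mE i : measurable (E i). Proof. exact: measurable_shift_preimage. Qed.

Let measurable_visits n k : measurable [set w | (k < visits n w)%N].
Proof.
elim: n k => [|n IHn] k.
  rewrite (_ : mkset _ = set0) //; apply/seteqP; split => w //=.
  by rewrite /visits big_ord0.
rewrite (_ : mkset _ = [set w | (k < visits n w)%N] `|`
    ((if k is k'.+1 then [set w | (k' < visits n w)%N] else setT) `&` E n)).
  apply: measurableU => //; apply: measurableI => //.
  by case: k => [|k]; [exact: measurableT|exact: IHn].
apply/seteqP; split => w /=; rewrite visitsS.
  have [En|En] := boolP (w \in E n); rewrite /= ?addn0; last by left.
  have [|h] := ltnP k (visits n w); [by left|rewrite addn1 ltnS => h2].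
  right; split; last by move: En; rewrite inE.
  by case: k h h2.
move=> [h|[h En]]; first by rewrite (leq_trans h) // leq_addr.
rewrite mem_set // /= addn1; by case: k h.
Qed.

Lemma measurable_visit_index k : measurable_fun setT (visit_index k).
Proof.
have m1 n : measurable (visit_index k @^-1` [set n]).
  case: n => [|n].
    (* A genuine index is positive, so 0 occurs exactly as the default value. *)
    rewrite (_ : _ @^-1` _ = ~` \bigcup_n [set w | (k < visits n w)%N]).
      by apply/measurableC/bigcupT_measurable => n; exact: measurable_visits.
    apply/seteqP; split => w /=.
      move=> h0 [n _ kn]; have [_ + _ _] := visit_indexP k w (ex_intro _ n kn).
      by rewrite h0.
    rewrite /visit_index => h; case: pselect => // -[n kn].
    by exfalso; apply: h; exists n.
  rewrite (_ : _ @^-1` _ = [set w | (k < visits n.+1 w)%N] `\`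
                           [set w | (k < visits n w)%N]).
    by apply: measurableD; exact: measurable_visits.
  apply/seteqP; split => w /=.
    move=> h; have ex : exists n, (k < visits n w)%N.
      by move: h; rewrite /visit_index; case: pselect.
    have [_ _ _ hP'] := visit_indexP _ _ ex.
    by rewrite !hP' h ltnn.
  move=> [h1 h2]; have ex : exists n, (k < visits n w)%N by exists n.+1.
  have [_ _ _ hP'] := visit_indexP _ _ ex.
  apply/eqP; rewrite eqn_leq -hP' h1 /= ltnNge -hP'; exact/negP.
move=> _ A mA; rewrite setTI.
rewrite (_ : _ @^-1` A = \bigcup_(n in A) (visit_index k @^-1` [set n])).
  exact: bigcup_measurable.
apply/seteqP; split => [w Aw|w [n An /= vn]]; first by exists (visit_index k w).
by rewrite /= vn.
Qed.

Context {nu : probability X R} {P : probability (paths X) R}.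
Hypothesis hP : is_product_measure nu P.
Variable p : R.
Hypotheses (N0 : (0 < N)%N) (dB : determined N B) (p0 : 0 < p) (PB : P B = p%:E).

Let PE i : P (E i) = p%:E. Proof. by rewrite (measure_shift hP). Qed.

(** Once both events are shifted back to the earlier block, the first is determined by [N]
    coordinates and the second starts at a positive multiple of [N]. *)
Let PEE i j : i != j -> P (E i `&` E j) = (p * p)%:E.
Proof.
wlog ij : i j / (i < j)%N => [wlg|_].
  move=> ne; have : (i < j)%N || (j < i)%N by rewrite -neq_ltn.
  by case/orP => h; [|rewrite setIC]; apply: wlg => //; rewrite eq_sym.
have -> : E i `&` E j = iter (N * i.+1) (@path_shift d X) @^-1`
    (B `&` iter (N * (j - i)) (@path_shift d X) @^-1` B).
  have h : (N * j.+1 = N * (j - i) + N * i.+1)%N by nia.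
  by apply/seteqP; split => w; rewrite /E /= h iterD.
rewrite (measure_shift hP); last first.
  by apply: measurableI => //; exact: measurable_shift_preimage.
rewrite (measure_determinedI hP) ?PB //.
by apply: determined_le dB; nia.
Qed.

Lemma ae_visits : {ae P, forall w, (visits n w)%:R / n%:R @[n --> \oo] --> p}.
Proof.
have := frequency_cvg P E p mE PE PEE; apply: filterS => w.
rewrite (_ : (fun n => (visits n w)%:R / n%:R) =
  (fun n => (\sum_(i < n) \1_(E i) w) / n%:R)) //.
by apply/funext => n; rewrite /visits natr_sum.
Qed.

(** By the tail sum formula the mean is the sum over [j] of the probability [(1 - p) ^+ j] that none
    of the first [j] counted blocks is visited. *)
Lemma expectation_visit_index :
  (\int[P]_w (visit_index 0 w)%:R%:E = (p^-1)%:E)%E.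
Proof.
have p1 : p <= 1 by rewrite -lee_fin -PB probability_le1.
pose A j : set (paths X) := [set w | visits j w = 0%N].
have mA j : measurable (A j).
  rewrite (_ : A j = ~` [set w | (0 < visits j w)%N]).
    by apply: measurableC; exact: measurable_visits.
  apply/seteqP; split => w /=; first by move=> ->.
  by move/negP; rewrite -eqn0Ngt => /eqP.
(* This is [A j] moved back by one block; it starts at coordinate 0, so that an induction can split
   off its first block. *)
pose C j : set (paths X) :=
  [set w | forall i, (i < j)%N -> (~` B) (iter (N * i) (@path_shift d X) w)].
have CS j : C j.+1 = ~` B `&` iter N (@path_shift d X) @^-1` C j.
  apply/seteqP; split => w /=.
    move=> h; split; first by have := h 0%N; rewrite muln0; apply.
    by move=> i ij; rewrite -iterD; have := h i.+1 ij; rewrite mulnS addnC.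
  move=> [h0 h] [|i] ij; first by rewrite muln0.
  by rewrite mulnS addnC iterD; exact: h.
have mC j : measurable (C j).
  elim: j => [|j IHj]; first by rewrite (_ : C 0%N = setT) //; apply/seteqP; split.
  rewrite CS; apply: measurableI; first exact: measurableC.
  exact: measurable_shift_preimage.
have PC j : P (C j) = ((1 - p) ^+ j)%:E.
  elim: j => [|j IHj].
    by rewrite (_ : C 0%N = setT) ?probability_setT //; apply/seteqP; split.
  rewrite CS (measure_determinedI hP) ?IHj //; last 2 first.
  - exact: measurableC.
  - exact: determinedC.
  by rewrite probability_setC // PB exprS EFinM EFinB.
have AE j : A j = iter N (@path_shift d X) @^-1` C j.
  apply/seteqP; split => w /=.
    move=> A0 i ij; rewrite -iterD => Bi.
    have : (0 < visits i.+1 w)%N.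
      by rewrite visitsS mem_set ?addn1 // /E /= mulnS addnC.
    by move/leq_trans => /(_ _ (visits_le _ _ _ ij)); rewrite A0.
  move=> h; apply/eqP; rewrite sum_nat_eq0; apply/forallP => i.
  rewrite eqb0; apply/negP; rewrite inE => Ei.
  by apply: (h i (ltn_ord i)); rewrite -iterD addnC -mulnS.
have PA j : P (A j) = ((1 - p) ^+ j)%:E by rewrite AE (measure_shift hP).
transitivity (\int[P]_w \sum_(j <oo) (\1_(A j) w)%:E)%E.
  apply: ae_eq_integral => //.
  - apply/measurable_EFinP.
    apply: (@measurableT_comp _ _ _ _ _ _ (fun n : nat => n%:R : R)) => //.
    exact: measurable_visit_index.
  - apply: ge0_emeasurable_sum => [j w _ _|j _]; first by rewrite lee_fin indicE.
    by apply/measurable_EFinP; exact: measurable_indic.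
  (* Almost surely some block is visited, so the default value of the index does not occur. The
     indicators then count the [j] below the index. *)
  have := ae_visits; apply: filterS => w vw _.
  have [_ _ _ h] := visit_indexP _ _ (visits_unbounded p p0 w vw 0%N).
  apply/esym/lim_near_cst => //; exists (visit_index 0 w) => // n /= hn.
  rewrite sumEFin (eq_bigr (fun j => (j < visit_index 0 w)%:R)); last first.
    move=> j _; rewrite indicE; congr (nat_of_bool _)%:R.
    by apply/idP/idP; rewrite inE /A /= ltnNge -h; case: (visits j w).
  rewrite (big_cat_nat _ hn) //=.
  rewrite (eq_big_nat _ _ (F2 := fun=> 1)) => [|j /andP[_ ->]//].
  rewrite [X in _ + X](eq_big_nat _ _ (F2 := fun=> 0)) => [|j /andP[]]; last first.
    by rewrite leqNgt => /negbTE ->.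
  by rewrite [X in _ + X]big1 // addr0 sumr_const_nat subn0.
rewrite (integral_nneseries P measurableT); last 2 first.
- by move=> j; apply/measurable_EFinP; exact: measurable_indic.
- by move=> j w _; rewrite lee_fin indicE.
rewrite (eq_eseriesr (g := fun j => ((1 - p) ^+ j)%:E)); last first.
  by move=> j _; rewrite integral_indic // setIT; exact: PA.
apply: cvg_lim => //.
rewrite (_ : (fun n => _) = EFin \o series (geometric 1 (1 - p))); last first.
  by apply/funext => n /=; rewrite sumEFin /series /=; under [in RHS]eq_bigr do rewrite mul1r.
apply: cvg_EFin; first exact: nearW.
have := @cvg_geometric_series R 1 (1 - p).
rewrite opprB addrCA subrr addr0 mul1r; apply.
by rewrite ger0_norm ?subr_ge0 // ltrBlDr ltrDl.
Qed.

End ReturnTimes.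

(** * Arcs, and the calculus of branches *)

Section Arcs.
Context {R : realType}.
Implicit Types (x y z : circle R) (a b c r s t : R).

Lemma clift_cproj r : - 2^-1 <= r < 2^-1 -> clift (cproj r) = r.
Proof.
move=> /andP[r1 r2].
have [m rm] : exists m : int, r - clift (cproj r) = m%:~R.
  by apply: cproj_eq0; rewrite cprojB cliftK subrr.
have := clift_ge (cproj r); have := clift_lt (cproj r) => c1 c2.
have m0 : m = 0.
  have : (m < 1)%R by rewrite -(ltr_int R) -rm; lra.
  have : (-1 < m)%R by rewrite -(ltr_int R) -rm; lra.
  lia.
by move: rm; rewrite m0 => /subr0_eq.
Qed.

Lemma clift0 : clift (0 : circle R) = 0.
Proof. by rewrite -cproj0 clift_cproj //; lra. Qed.

Lemma mdist_clift x y : mdist x y = `|clift (x - y)|.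
Proof. by []. Qed.

Definition circle_arc a b : set (circle R) := cproj @` `]a, b[.

Lemma circle_arc_sub a b a' b' : a <= a' -> b' <= b -> circle_arc a' b' `<=` circle_arc a b.
Proof.
move=> aa bb _ [r /= rab <-]; exists r => //=.
by move: rab; rewrite !in_itv /=; lra.
Qed.

Lemma circle_arc_open a b : open (circle_arc a b).
Proof.
rewrite openE => _ [r /= + <-]; rewrite in_itv /= => /andP[ar rb].
apply/nbhs_ballP; exists (Num.min (r - a) (b - r)) => /=.
  by rewrite lt_min !subr_gt0 ar.
move=> y; rewrite /ball /= => h.
have {}h : `|clift (cproj r - y)| < Num.min (r - a) (b - r) by exact: h.
exists (r - clift (cproj r - y)).
  rewrite /= in_itv /=; move: h; rewrite lt_min !ltr_norml.
  move=> /andP[/andP[_ h1] /andP[h2 _]]; apply/andP; split; lra.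
by rewrite cprojB cliftK opprB addrC subrK.
Qed.

Lemma measurable_circle_arc a b : measurable (circle_arc a b).
Proof. by apply: sub_sigma_algebra; exact: circle_arc_open. Qed.

Lemma circle_interval_arc a b : a < b -> circle_interval (circle_arc a b).
Proof.
move=> ab; split.
  apply: connected_continuous_connected.
    by apply/connected_intervalP; exact: interval_is_interval.
  by apply: continuous_subspaceT; exact: cproj_continuous.
exists (cproj ((a + b) / 2)).
apply: open_nbhs_nbhs; split; first exact: circle_arc_open.
by exists ((a + b) / 2) => //=; rewrite in_itv /=; lra.
Qed.

Lemma open_contains_arc (U : set (circle R)) : open U -> U !=set0 ->
  exists a b : rat, [/\ ratr a < ratr b :> R & circle_arc (ratr a) (ratr b) `<=` U].
Proof.
move=> oU [z Uz].
have oV : open (cproj @^-1` U) by move/continuousP: (@cproj_continuous R); apply.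
have Vz : (cproj @^-1` U) (clift z) by rewrite /preimage /= cliftK.
move: oV; rewrite openE => /(_ _ Vz)/nbhs_ballP[e /= e0 he].
have [a] : exists a : rat, ratr a \in `]clift z - e, clift z[.
  by apply: rat_in_itvoo; lra.
have [b] : exists b : rat, ratr b \in `]clift z, clift z + e[.
  by apply: rat_in_itvoo; lra.
rewrite !in_itv /= => /andP[b1 b2] /andP[a1 a2].
exists a, b; split; first lra.
move=> _ [r /= + <-]; rewrite in_itv /= => /andP[ar rb].
by apply: he; rewrite /ball /= ltr_norml; apply/andP; split; lra.
Qed.

(** The bounds keep the arc within one fundamental domain [[m, m + 1]], so it does not wrap and
    lifts to a single translate of []a, b[]. *)
Lemma circle_leb_arc a b (m : int) : m%:~R <= a -> a < b -> b <= m%:~R + 1 ->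
  circle_leb (circle_arc a b) = (b - a)%:E.
Proof.
move=> ma ab bm; rewrite /circle_leb.
have -> : `[0%R, 1%R[ `&` cproj @^-1` (circle_arc a b) = `]a - m%:~R, b - m%:~R[%classic.
  apply/seteqP; split => r /=; rewrite !in_itv /=.
    move=> [/andP[r0 r1] [s /= + /esym rs]]; rewrite in_itv /= => /andP[as_ sb].
    have [k rk] : exists k : int, r - s = k%:~R.
      by apply: cproj_eq0; rewrite cprojB rs subrr.
    have km : k = - m.
      have : (k + m < 1)%R by rewrite -(ltr_int R) intrD -rk; lra.
      have : (-1 < k + m)%R by rewrite -(ltr_int R) intrD -rk; lra.
      lia.
    move: rk; rewrite km mulrNz => rk; apply/andP; split; lra.
  move=> /andP[h1 h2]; split; first by apply/andP; split; lra.
  exists (r + m%:~R); first by rewrite /= in_itv /=; apply/andP; split; lra.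
  by rewrite cprojD cproj_int addr0.
rewrite lebesgue_measure_itv /= lte_fin ltrD2r ab -EFinD; congr (_%:E); lra.
Qed.

End Arcs.

(** * Composition and extension of expanding branches *)

Section Branches.
Context {R : realType}.
Implicit Types (g h : circle R -> circle R) (x y z : circle R).

Lemma local_lift0 g x : local_lift g x 0 = 0.
Proof. by rewrite /local_lift cproj0 addr0 subrr clift0. Qed.

(** [clift] changes the increment by an integer only, which [cproj] forgets; so the identity holds
    for all increments, not only for small ones. *)
Lemma local_lift_comp h g x :
  local_lift (h \o g) x = local_lift h (g x) \o local_lift g x.
Proof.
by apply/funext => t; rewrite /local_lift /= cliftK (addrC (g x)) subrK.
Qed.

Lemma differentiable_atP g x : differentiable_at g x ->
  is_derive (0 : R) 1 (local_lift g x) (dmap g x).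
Proof.
move=> dg; rewrite /dmap asboolT // derive1E; exact: derivableP.
Qed.

Lemma is_derive_dmap g x v : is_derive (0 : R) 1 (local_lift g x) v ->
  differentiable_at g x /\ dmap g x = v.
Proof.
move=> [dg <-]; split => //; by rewrite /dmap asboolT // derive1E.
Qed.

Lemma dmap_comp h g x : differentiable_at g x -> differentiable_at h (g x) ->
  differentiable_at (h \o g) x /\ dmap (h \o g) x = dmap h (g x) * dmap g x.
Proof.
move=> /differentiable_atP dg /differentiable_atP dh.
apply: is_derive_dmap; rewrite local_lift_comp.
by apply: is_derive1_comp; rewrite local_lift0.
Qed.

Lemma dmap_id x : differentiable_at id x /\ dmap id x = 1.
Proof.
apply: is_derive_dmap.
apply: (@near_eq_is_derive _ _ _ id).
near=> t; rewrite /local_lift /= (addrC x) addrK clift_cproj //.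
have : `|t| < 2^-1.
  by near: t; apply/nbhs_ballP; exists 2^-1 => //= t; rewrite /ball /= sub0r normrN.
by rewrite ltr_norml => /andP[t1 t2]; rewrite t2 ltW.
Unshelve. all: by end_near. Qed.

Context {d : measure_display} {X : measurableType d}.
Variable g : paths X -> circle R -> circle R.
Implicit Types (w : paths X) (A B C : set (circle R)) (e : R).

Lemma cocycleD m n w :
  cocycle g (m + n) w = cocycle g n (iter m (@path_shift d X) w) \o cocycle g m w.
Proof.
elim: n => [|n IHn]; first by rewrite addn0.
rewrite addnS /=; apply/funext => x /=; rewrite IHn /=.
by rewrite -iterD addnC.
Qed.

(** In contrast with [full_branch_expanding] the time is exact and the target arbitrary. The domain
    [J] is any set, so restricting and composing branches only takes preimages. *)
Definition branch n w A B e := exists J, [/\ J `<=` A,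
  cocycle g n w @` J = B & expands_on (cocycle g n w) e J].

Lemma branchS n w A A' B B' e e' : branch n w A B e ->
  A `<=` A' -> B' `<=` B -> e' <= e -> branch n w A' B' e'.
Proof.
move=> [J [JA gJ eJ]] AA BB ee.
exists (J `&` cocycle g n w @^-1` B'); split.
- by move=> x [/JA/AA].
- apply/seteqP; split => [_ [x [_ Bx] <-]//|y B'y].
  have : (cocycle g n w @` J) y by rewrite gJ; exact: BB.
  by move=> [x Jx xy]; exists x => //; split => //; rewrite /preimage /= xy.
- move=> x [/eJ[dx ex] _]; split => //; exact: le_lt_trans ex.
Qed.

Lemma branch_comp m n w A B C e e' : 0 <= e -> 0 <= e' ->
  branch m w A B e -> branch n (iter m (@path_shift d X) w) B C e' ->
  branch (m + n) w A C (e' * e).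
Proof.
move=> e0 e'0 [J [JA gJ eJ]] [K [KB gK eK]].
exists (J `&` cocycle g m w @^-1` K); split.
- by move=> x [/JA].
- rewrite cocycleD; apply/seteqP; split.
    by move=> _ [x [_ Kx] <-] /=; rewrite -gK; exists (cocycle g m w x).
  move=> z; rewrite -gK => -[y Ky <-].
  have : (cocycle g m w @` J) y by rewrite gJ; exact: KB.
  by move=> [x Jx xy]; exists x => /=; rewrite ?xy //; split => //=; rewrite xy.
- move=> x [/eJ[dx ex] /eK[dy ey]]; rewrite cocycleD.
  have [dc ->] := dmap_comp _ _ _ dx dy; split => //.
  by rewrite normrM ltr_pM.
Qed.

(** The bound has to lie below the derivative 1 of the identity because [expands_on] is strict. *)
Lemma branch0 w A e : e < 1 -> branch 0 w A A e.
Proof.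
move=> e1; exists A; split => //; first by rewrite image_id.
move=> x _; have [dx dE] := dmap_id x.
by split; [exact: dx|rewrite [dmap _ _]dE normr1].
Qed.

(** Each further step follows the branch by one of the whole circle onto itself and gains a factor
    [c]. *)
Lemma branch_setT_extend c n m w A e : 1 < c -> 0 <= e ->
  (forall i, branch 1 (iter i (@path_shift d X) w) setT setT c) ->
  branch n w A setT e -> branch (n + m) w A setT (c ^+ m * e).
Proof.
move=> c1 e0 hc be; elim: m => [|m IHm]; first by rewrite addn0 expr0 mul1r.
rewrite addnS -addn1 exprS -mulrA.
apply: branch_comp IHm (hc _).
- by rewrite mulr_ge0 // exprn_ge0 //; lra.
- lra.
Qed.

Lemma full_branch_expandingP w kappa K A :
  full_branch_expanding g w kappa K A <->
  exists2 i, (i <= K)%N & branch i w A setT kappa.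
Proof.
split; first by move=> [J [i [JA iK gJ eJ]]]; exists i => //; exists J.
by move=> [i iK [J [JA gJ eJ]]]; exists J, i.
Qed.

Lemma cocycle_determined n w w' :
  (forall v v' : paths X, v 0%N = v' 0%N -> g v = g v') ->
  (forall i, (i < n)%N -> w i = w' i) -> cocycle g n w = cocycle g n w'.
Proof.
move=> g0; elim: n => // n IHn ww'; apply/funext => x /=.
rewrite IHn => [|i ni]; last by apply: ww'; rewrite ltnS ltnW.
by rewrite (g0 _ (iter n (@path_shift d X) w')) // !iter_shiftE addn0 ww'.
Qed.

End Branches.

(** * Charts *)

(** Continuity is asked at [x] alone, so that inequalities in several variables can be extended from
    the rationals one variable at a time. *)
Lemma ge0_of_rat {R : realType} (f : R -> R) (p q x : R) :
  f @ x --> f x -> p < x < q ->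
  (forall s : rat, p < ratr s < q -> 0 <= f (ratr s)) -> 0 <= f x.
Proof.
move=> fx /andP[px xq] fs; rewrite leNgt; apply/negP => fx0.
have /nbhs_ballP[e /= e0 he] : \forall s \near x, f s < 0.
  by move/cvgr_lt : fx; apply.
have [s] : exists s : rat, ratr s \in `]x, Num.min q (x + e)[.
  by apply: rat_in_itvoo; rewrite lt_min xq; lra.
rewrite in_itv /= lt_min => /and3P[xs sq se].
have := fs s; rewrite sq (lt_trans px xs) => /(_ isT); apply/negP; rewrite -ltNge.
by apply: he; rewrite /ball /= ltr_norml; apply/andP; split; lra.
Qed.

Section Chart.
Context {R : realType}.
Implicit Types (h : circle R -> circle R) (p q a e L M : R).

Definition lift_at h a (t : R) : R := clift (h (cproj t) - cproj a).

(** With both lifts at most 1/8 their difference stays within ]-1/2, 1/2[, so no integer is lost.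
    This is where the first clause of [chart] comes from. *)
Lemma clift_subE (x z : circle R) : `|clift x| <= 8^-1 -> `|clift z| <= 8^-1 ->
  clift (x - z) = clift x - clift z.
Proof.
move=> hx hz; rewrite -[in LHS](cliftK x) -[in LHS](cliftK z) -cprojB clift_cproj //.
by move: hx hz; rewrite !ler_norml; lra.
Qed.

(* All clauses quantify over rational points only, so that they define
   measurable events when [h] is random. By continuity they extend to the whole
   interval, where the second one bounds the variation of the difference
   quotients and so makes the lift differentiable. *)
Definition chart h a p q L M e : Prop :=
  let F s := lift_at h a (ratr s) in
  let I (s : rat) := p < ratr s < q in
  [/\ forall s, I s -> `|F s| <= 8^-1,
      forall s1 s2 s3, I s1 -> I s2 -> I s3 ->
        `|(ratr s3 - ratr s1) * (F s2 - F s1) - (ratr s2 - ratr s1) * (F s3 - F s1)| <=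
        L * (`|ratr s2 - ratr s1| * `|ratr s3 - ratr s1| *
             (`|ratr s2 - ratr s1| + `|ratr s3 - ratr s1|)),
      forall s1 s2, I s1 -> I s2 -> `|ratr s2 - ratr s1| <= M * `|F s2 - F s1| &
      exists s1 s2, [/\ I s1, I s2, F s1 < 0 & e < F s2]].

Section ChartBranch.
Context {h : circle R -> circle R} {a p q L M e : R}.
Hypotheses (ch : continuous h) (hc : chart h a p q L M e).
Let F := lift_at h a.

Let cvg_h (t : R) : h (cproj s) @[s --> t] --> h (cproj t).
Proof. by apply: continuous_comp; [exact: cproj_continuous|exact: ch]. Qed.

Let near_h (t : R) (eps : R) : 0 < eps ->
  \forall s \near t, mdist (h (cproj t)) (h (cproj s)) < eps.
Proof.
by move=> eps0; move/metricType_numDomainType.cvgrPdist_lt : (cvg_h t); apply.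
Qed.

Let F_le (t : R) : p < t < q -> `|F t| <= 8^-1.
Proof.
move=> tpq; rewrite -subr_ge0.
apply: (ge0_of_rat (fun t => 8^-1 - `|F t|) p q t) => //.
  apply: cvgB; first exact: cvg_cst.
  apply/cvgrPdist_lt => eps eps0; near=> s.
  have st : mdist (h (cproj t)) (h (cproj s)) < eps by near: s; exact: near_h.
  have /= t1 := cdist_triangle (h (cproj s)) (h (cproj t)) (cproj a).
  have /= t2 := cdist_triangle (h (cproj t)) (h (cproj s)) (cproj a).
  rewrite (cdist_sym (h (cproj s)) (h (cproj t))) in t2.
  rewrite -[`|F t|]/(cdist _ _) -[`|F s|]/(cdist _ _).
  rewrite -[mdist _ _]/(cdist _ _) in st.
  rewrite ltr_norml; apply/andP; split; lra.
by case: hc => + _ _ _ s Is; rewrite subr_ge0; apply.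
Unshelve. all: by end_near. Qed.

Let near_in (t : R) : p < t < q -> \forall s \near t, p < s < q.
Proof.
move=> /andP[pt tq]; near=> s; apply/andP; split.
  by near: s; exact: lt_nbhsr.
by near: s; exact: lt_nbhsl.
Unshelve. all: by end_near. Qed.

Let F_sub s t : p < s < q -> p < t < q ->
  F s - F t = clift (h (cproj s) - h (cproj t)).
Proof.
move=> /F_le Fs /F_le Ft; rewrite -clift_subE //; congr clift.
by rewrite opprB addrA subrK.
Qed.

Let F_cvg (t : R) : p < t < q -> F @ t --> F t.
Proof.
move=> tpq; apply/cvgrPdist_lt => eps eps0; near=> s.
rewrite F_sub //; last by near: s; exact: near_in.
rewrite -mdist_clift; near: s; exact: near_h.
Unshelve. all: by end_near. Qed.

Let F_quot s1 s2 s3 : p < s1 < q -> p < s2 < q -> p < s3 < q ->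
  `|(s3 - s1) * (F s2 - F s1) - (s2 - s1) * (F s3 - F s1)| <=
        L * (`|s2 - s1| * `|s3 - s1| * (`|s2 - s1| + `|s3 - s1|)).
Proof.
pose G s1 s2 s3 := L * (`|s2 - s1| * `|s3 - s1| * (`|s2 - s1| + `|s3 - s1|)) -
  `|(s3 - s1) * (F s2 - F s1) - (s2 - s1) * (F s3 - F s1)|.
have cG (f1 f2 f3 : R -> R) t : p < f1 t < q -> p < f2 t < q -> p < f3 t < q ->
    (f1 @ t --> f1 t) -> (f2 @ t --> f2 t) -> (f3 @ t --> f3 t) ->
    (fun t => G (f1 t) (f2 t) (f3 t)) @ t --> G (f1 t) (f2 t) (f3 t).
  move=> i1 i2 i3 c1 c2 c3.
  have cF (f : R -> R) : p < f t < q -> (f @ t --> f t) -> (F \o f) @ t --> F (f t).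
    by move=> fi cf; apply: (cvg_comp _ _ cf); exact: F_cvg.
  have F1 := cF _ i1 c1; have F2 := cF _ i2 c2; have F3 := cF _ i3 c3.
  have d2 : (fun t => `|f2 t - f1 t|) @ t --> `|f2 t - f1 t|.
    by apply: cvg_norm; exact: cvgB.
  have d3 : (fun t => `|f3 t - f1 t|) @ t --> `|f3 t - f1 t|.
    by apply: cvg_norm; exact: cvgB.
  apply: cvgB.
    apply: cvgM; first exact: cvg_cst.
    apply: cvgM; last exact: cvgD.
    exact: cvgM.
  apply: cvg_norm; apply: cvgB; apply: cvgM; exact: cvgB.
move=> I1 I2 I3; rewrite -subr_ge0 -/(G s1 s2 s3).
have [_ h2 _ _] := hc.
apply: (ge0_of_rat (fun s => G s s2 s3) _ _ _ _ I1).
  by apply: (cG id (cst s2) (cst s3)) => //; exact: cvg_cst.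
move=> r1 J1; apply: (ge0_of_rat (fun s => G (ratr r1) s s3) _ _ _ _ I2).
  by apply: (cG (cst _) id (cst s3)) => //; exact: cvg_cst.
move=> r2 J2; apply: (ge0_of_rat (fun s => G (ratr r1) (ratr r2) s) _ _ _ _ I3).
  by apply: (cG (cst _) (cst _) id) => //; exact: cvg_cst.
by move=> r3 J3; rewrite subr_ge0; exact: h2.
Qed.

Let F_expand s1 s2 : p < s1 < q -> p < s2 < q ->
  `|s2 - s1| <= M * `|F s2 - F s1|.
Proof.
move=> I1 I2; rewrite -subr_ge0.
have [_ _ h3 _] := hc.
have c1 := F_cvg _ I1; have c2 := F_cvg _ I2.
apply: (ge0_of_rat (fun s => M * `|F s2 - F s| - `|s2 - s|) _ _ _ _ I1).
  apply: cvgB.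
    apply: cvgM; first exact: cvg_cst.
    by apply: cvg_norm; apply: cvgB => //; exact: cvg_cst.
  by apply: cvg_norm; apply: cvgB; [exact: cvg_cst|exact: cvg_id].
move=> r1 J1.
apply: (ge0_of_rat (fun s => M * `|F s - F (ratr r1)| - `|s - ratr r1|) _ _ _ _ I2).
  apply: cvgB.
    apply: cvgM; first exact: cvg_cst.
    by apply: cvg_norm; apply: cvgB => //; exact: cvg_cst.
  by apply: cvg_norm; apply: cvgB; [exact: cvg_id|exact: cvg_cst].
by move=> r2 J2; rewrite subr_ge0; exact: h3.
Qed.

Let quot (x k : R) := (F (x + k) - F x) / k.

Let near_shift_in (x : R) : p < x < q -> \forall k \near (0 : R), p < x + k < q.
Proof.
move=> xpq; have := near_in _ xpq; rewrite (near_shift 0); apply: filterS => k /=.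
by rewrite subr0 addrC.
Qed.

Let quot_sub x k k' : p < x < q -> p < x + k < q -> p < x + k' < q ->
  k != 0 -> k' != 0 -> `|quot x k - quot x k'| <= L * (`|k| + `|k'|).
Proof.
move=> Ix Ik Ik' k0 k0'; have := F_quot _ _ _ Ix Ik Ik'.
have addK (u : R) : x + u - x = u by rewrite addrAC subrr add0r.
rewrite !addK => hq.
have kk : 0 < `|k| * `|k'| by rewrite mulr_gt0 // normr_gt0.
have -> : quot x k - quot x k' =
    (k' * (F (x + k) - F x) - k * (F (x + k') - F x)) / (k * k').
  by rewrite /quot; field; rewrite k0 k0'.
rewrite normrM normfV normrM ler_pdivrMr //; apply: (le_trans hq).
by rewrite le_eqVlt; apply/orP; left; apply/eqP; ring.
Qed.

Let cvg_quot (x : R) : p < x < q -> cvg (quot x @ 0^').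
Proof.
move=> xpq; apply/cauchy_cvgP; apply: cauchy_exP => eps eps0.
(* The sign of [L] is not prescribed, hence the positive denominator built from [|L| + 1]. *)
have e1 : 0 < eps / (2 * (`|L| + 1)).
  by rewrite divr_gt0 // mulr_gt0 // ltr_wpDl.
have nI : \forall k \near (0 : R)^', p < x + k < q.
  exact: nbhs_dnbhs (near_shift_in _ xpq).
near (0 : R)^' => k0; exists (quot x k0).
have : \forall k \near (0 : R)^', `|quot x k0 - quot x k| < eps; last by [].
near=> k.
apply: (le_lt_trans (quot_sub x k0 k xpq _ _ _ _)) => //.
- by near: k0.
- by near: k.
- by near: k0; exact: nbhs_dnbhs_neq.
- by near: k; exact: nbhs_dnbhs_neq.
have a1 : `|k0| < eps / (2 * (`|L| + 1)) by near: k0; exact: dnbhs0_lt.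
have a2 : `|k| < eps / (2 * (`|L| + 1)) by near: k; exact: dnbhs0_lt.
apply: (@le_lt_trans _ _ (`|L| * (`|k0| + `|k|))).
  by rewrite ler_wpM2r ?addr_ge0 // ler_norm.
have : `|k0| + `|k| < eps / (`|L| + 1).
  apply: lt_le_trans (ltrD a1 a2) _.
  have L1 : `|L| + 1 != 0 by rewrite gt_eqF // ltr_wpDl.
  by rewrite le_eqVlt; apply/orP; left; apply/eqP; field.
rewrite ltr_pdivlMr ?ltr_wpDl // => h2.
apply: le_lt_trans h2; rewrite mulrC ler_wpM2l ?addr_ge0 //; lra.
Unshelve. all: by end_near. Qed.

Let lift_near (x : R) : p < x < q ->
  \forall k \near (0 : R), F (x + k) - F x = local_lift h (cproj x) k.
Proof.
move=> xpq; near=> k; rewrite F_sub //; last by near: k; exact: near_shift_in.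
by rewrite /local_lift cprojD.
Unshelve. all: by end_near. Qed.

(** The difference quotients converge by [cvg_quot], and the third clause of [chart] bounds their
    absolute values below by the inverse of [M]; the limit inherits this bound. *)
Let chart_expands x : 0 < M -> p < x < q ->
  differentiable_at h (cproj x) /\ M^-1 <= `|dmap h (cproj x)|.
Proof.
move=> M0 xpq; set G := fun k => F (x + k) - F x.
have qE : (fun k : R => k^-1 *: ((G \o shift 0) (k *: 1) - G 0)) = quot x.
  apply/funext => k; rewrite /G /quot /= addr0 [k *: 1]mulr1 addr0 subrr subr0.
  by rewrite mulrC.
have dG : is_derive (0 : R) 1 G (lim (quot x @ 0^')).
  split; first by rewrite /derivable qE; exact: cvg_quot.
  by rewrite /derive qE.
have dl : is_derive (0 : R) 1 (local_lift h (cproj x)) (lim (quot x @ 0^')).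
  by apply: near_eq_is_derive; exact: lift_near.
have [dh ->] := is_derive_dmap _ _ _ dl.
split => //.
have cq := cvg_quot _ xpq.
have -> : `|lim (quot x @ 0^')| = lim ((fun k => `|quot x k|) @ 0^').
  by apply/esym/cvg_lim => //; exact: cvg_norm.
apply: limr_ge; first by apply: cvgP; apply: cvg_norm; exact: cq.
near=> k.
have k0 : k != 0 by near: k; exact: nbhs_dnbhs_neq.
have Ik : p < x + k < q by near: k; exact: nbhs_dnbhs (near_shift_in _ xpq).
have := F_expand _ _ xpq Ik; rewrite addrAC subrr add0r => kF.
rewrite /quot normrM normfV ler_pdivlMr ?normr_gt0 //.
by rewrite mulrC ler_pdivrMr // mulrC.
Unshelve. all: by end_near. Qed.

Lemma chart_branch : 0 < M -> exists J, [/\ J `<=` circle_arc p q,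
  h @` J = circle_arc a (a + e) & forall x, J x -> differentiable_at h x /\ M^-1 <= `|dmap h x|].
Proof.
move=> M0; exists (circle_arc p q `&` h @^-1` circle_arc a (a + e)); split => //.
- apply/seteqP; split => [_ [x [_ hx] <-]//|_ [u /= + <-]].
  rewrite in_itv /= => /andP[au ue].
  have [_ _ _ [s1 [s2 [I1 I2 F1 F2]]]] := hc.
  (* The intermediate value theorem between the two points of the last clause of [chart], which may
     come in either order as the lift may decrease. *)
  have [c cI Fc] : exists2 c, p < c < q & F c = u - a.
    have cI t1 t2 : p < t1 < q -> p < t2 < q -> {within `[t1, t2], continuous F}.
      move=> J1 J2; apply: continuous_in_subspaceT => c /set_mem /=.
      by rewrite in_itv /= => c12; apply: F_cvg; lra.
    have [s12|s21] := leP (ratr s1 : R) (ratr s2).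
      have [|c] := IVT s12 (cI _ _ I1 I2) (v := u - a).
      - by rewrite ge_min le_max; apply/andP; split; apply/orP; [left|right];
          rewrite /F; lra.
      - by rewrite in_itv /= => c12 Fc; exists c => //; lra.
    have [|c] := IVT (ltW s21) (cI _ _ I2 I1) (v := u - a).
    - by rewrite ge_min le_max; apply/andP; split; apply/orP; [right|left];
        rewrite /F; lra.
    - by rewrite in_itv /= => c12 Fc; exists c => //; lra.
  exists (cproj c); last first.
    by rewrite -[LHS](subrK (cproj a)) -(cliftK (_ - _)) -/(lift_at h a c) -/F Fc cprojB subrK.
  split; first by exists c => //=; rewrite in_itv.
  exists u; first by rewrite /= in_itv /= au.
  by rewrite -[RHS](subrK (cproj a)) -(cliftK (_ - _)) -/(lift_at h a c) -/F Fc cprojB subrK.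
- by move=> _ [[x + <-] _]; rewrite /= in_itv /=; exact: chart_expands.
Qed.

End ChartBranch.
End Chart.

(** * Existence of charts near regular points *)

Lemma is_derive_shift0 {R : realType} (f : R -> R) (t : R) :
  derivable (fun k => f (t + k)) 0 1 ->
  is_derive t 1 f (derive1 (fun k => f (t + k)) 0).
Proof.
have E : (fun k : R => k^-1 *: ((((fun k => f (t + k)) \o shift 0) (k *: 1)) - f (t + 0))) =
         (fun k : R => k^-1 *: ((f \o shift t) (k *: 1) - f t)).
  by apply/funext => k /=; rewrite !addr0 (addrC t).
move=> df; split; first by move: df; rewrite /derivable E.
by rewrite derive1E /derive E.
Qed.

Lemma is_derive_increment {R : realType} (f : R -> R) (t v : R) :
  is_derive (0 : R) 1 (fun k => f (t + k) - f t) v -> is_derive t 1 f v.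
Proof.
have E : (fun k : R => k^-1 *: ((((fun k => f (t + k) - f t) \o shift 0) (k *: 1)) -
                                (f (t + 0) - f t))) =
         (fun k : R => k^-1 *: ((f \o shift t) (k *: 1) - f t)).
  by apply/funext => k /=; rewrite !addr0 subrr subr0 (addrC t).
move=> [df <-]; split; first by move: df; rewrite /derivable E.
by rewrite /derive E.
Qed.

Lemma MVT_unordered {R : realType} (f df : R -> R) (p q s t : R) :
  (forall x, p < x < q -> is_derive x 1 f (df x)) -> p < s < q -> p < t < q ->
  exists c, [/\ p < c < q, `|c - s| <= `|t - s| & f t - f s = df c * (t - s)].
Proof.
move=> hf.
have cf (u v : R) : p < u < q -> p < v < q -> {within `[u, v], continuous f}.
  move=> Iu Iv; apply: continuous_in_subspaceT => x /set_mem /=.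
  rewrite in_itv /= => xuv; have Ix : p < x < q by lra.
  have := hf x Ix; move=> [dfx _].
  by apply: differentiable_continuous; apply/derivable1_diffP.
move=> Is It; have [st|ts] := leP s t.
  have [|c] := MVT_segment st _ (cf _ _ Is It) (df := df).
    by move=> x; rewrite in_itv /= => xst; apply: hf; lra.
  rewrite in_itv /= => cst fE; exists c; split => //; first lra.
  by rewrite !ger0_norm; lra.
have [|c] := MVT_segment (ltW ts) _ (cf _ _ It Is) (df := df).
  by move=> x; rewrite in_itv /= => xst; apply: hf; lra.
rewrite in_itv /= => cst fE; exists c; split => //; first lra.
  by rewrite !ler0_norm; lra.
by move: fE; lra.
Qed.

Section ExistsChart.
Context {R : realType}.
Variables (h : circle R -> circle R).
Hypotheses (ch : continuous h) (C2h : piecewise_C2 h) (bh : bounded_derivatives h).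

Let D (t : R) := dmap h (cproj t).

Let is_derive_D (t : R) : ~ nondiff_set h (cproj t) ->
  is_derive t 1 D (d2map h (cproj t)).
Proof.
move=> /C2h.2 [dh _].
have E : (fun k => dmap h (cproj t + cproj k)) = (fun k => D (t + k)).
  by apply/funext => k; rewrite /D cprojD.
by rewrite /d2map E in dh *; exact: is_derive_shift0.
Qed.

Let near_diff (t : R) : ~ nondiff_set h (cproj t) ->
  \forall s \near t, ~ nondiff_set h (cproj s).
Proof.
move=> nt.
have oS : open (cproj @^-1` (~` nondiff_set h)).
  move/continuousP: (@cproj_continuous R); apply; rewrite openC.
  have := (@accessible_finite_set_closed (circle R)).1; apply; last exact: C2h.1.
  exact/hausdorff_accessible/metric_hausdorff.
exact: open_nbhs_nbhs.
Qed.

Let near_h (t eps : R) : 0 < eps ->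
  \forall s \near t, `|clift (h (cproj s) - h (cproj t))| < eps.
Proof.
move=> eps0; near=> s; rewrite -[`|_|]/(cdist _ _) cdist_sym; near: s.
have : h (cproj s) @[s --> t] --> h (cproj t).
  by apply: continuous_comp; [exact: cproj_continuous|exact: ch].
by move/metricType_numDomainType.cvgrPdist_lt; apply.
Unshelve. all: by end_near. Qed.

(** Near [r] the derivative stays away from 0 and the second derivative is bounded. By the mean
    value theorem the former gives the third clause of [chart] and the latter, applied to the
    derivative, the second. *)
Lemma exists_chart (a b r : R) : a < r < b ->
  differentiable_at h (cproj r) -> dmap h (cproj r) != 0 ->
  exists (p q c e : rat) (L M : nat),
    [/\ a <= ratr p, ratr q <= b, 0 < e, (0 < M)%N &
        chart h (ratr c) (ratr p) (ratr q) L%:R M%:R (ratr e)].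
Proof.
move=> /andP[ar rb] dr Dr.
(* A real lift of [h] based at [r], which near [r] has no jump even if [h (cproj r)] is close to the
   discontinuity of [clift]. *)
pose F t := clift (h (cproj r)) + clift (h (cproj t) - h (cproj r)).
have FE t : cproj (F t) = h (cproj t) by rewrite cprojD !cliftK addrC subrK.
have Dr2 : `|D r| / 2 < `|D r| by rewrite ltr_pdivrMr // ltr_pMr ?normr_gt0 // ltr1n.
have nr : ~ nondiff_set h (cproj r) by apply.
have cD : D @ r --> D r.
  have [dD _] := is_derive_D _ nr.
  by apply: differentiable_continuous; apply/derivable1_diffP.
(* With 1/16 here, any two values of [F] differ by less than 1/8, so centring at a number between
   two values of [F] respects the bound of [chart]. *)
have : \forall t \near r, [/\ ~ nondiff_set h (cproj t),
    `|clift (h (cproj t) - h (cproj r))| < 16^-1 & `|D r| / 2 < `|D t|].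
  near=> t; split.
  - by near: t; exact: near_diff.
  - by near: t; apply: near_h; lra.
  - by near: t; exact: (cvgr_norm_gt _ cD).
move=> /nbhs_ballP[rho /= rho0 hrho].
have [p] : exists p : rat, ratr p \in `]Num.max a (r - rho), r[.
  by apply: rat_in_itvoo; rewrite gt_max ar; lra.
rewrite in_itv /= gt_max => /andP[/andP[ap rp] pr].
have [q] : exists q : rat, ratr q \in `]r, Num.min b (r + rho)[.
  by apply: rat_in_itvoo; rewrite lt_min rb; lra.
rewrite in_itv /= lt_min => /andP[rq /andP[qb qr]].
have inI (t : R) : ratr p < t < ratr q -> [/\ ~ nondiff_set h (cproj t),
    `|clift (h (cproj t) - h (cproj r))| < 16^-1 & `|D r| / 2 < `|D t|].
  move=> tpq; apply: hrho; rewrite /ball /= ltr_norml; lra.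
have dF (t : R) : ratr p < t < ratr q -> is_derive t 1 F (D t).
  move=> It; have [nt t16 _] := inI _ It.
  apply: is_derive_increment.
  have dt : differentiable_at h (cproj t) by exact: contrapT.
  apply: near_eq_is_derive (differentiable_atP _ _ dt).
  near=> k.
  have Ik : ratr p < t + k < ratr q.
    near: k; apply/nbhs_ballP.
    exists (Num.min (t - ratr p) (ratr q - t)) => /=; first by rewrite lt_min; lra.
    move=> k; rewrite /ball /= sub0r normrN lt_min !ltr_norml; lra.
  have [_ k16 _] := inI _ Ik.
  rewrite /F /local_lift -cprojD opprD addrACA subrr add0r -clift_subE; [|lra|lra].
  by congr clift; rewrite opprB addrA subrK.
have dD (t : R) : ratr p < t < ratr q -> is_derive t 1 D (d2map h (cproj t)).
  by move=> /inI[nt _ _]; exact: is_derive_D.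
have mvtF := MVT_unordered F D (ratr p) (ratr q) _ _ dF.
have mvtD := MVT_unordered D _ (ratr p) (ratr q) _ _ dD.
have [K hK] := bh.
pose L := (Num.truncn K).+1.
have KL : K <= L%:R by exact/ltW/truncnS_gt.
have D_lip (s t : R) : ratr p < s < ratr q -> ratr p < t < ratr q ->
    `|D t - D s| <= L%:R * `|t - s|.
  move=> Is It; have [x [Ix _ ->]] := mvtD _ _ Is It.
  rewrite normrM ler_wpM2r //; apply: le_trans KL.
  by have [nx _ _] := inI _ Ix; have [] := hK _ nx.
pose M := (Num.truncn (`|D r| / 2)^-1).+1.
have MD : (`|D r| / 2)^-1 <= M%:R by exact/ltW/truncnS_gt.
have D20 : 0 < `|D r| / 2 by rewrite divr_gt0 // normr_gt0.
have F_exp (s t : R) : ratr p < s < ratr q -> ratr p < t < ratr q ->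
    `|t - s| <= M%:R * `|F t - F s|.
  move=> Is It; have [x [Ix _ ->]] := mvtF _ _ Is It.
  have [_ _ xD] := inI _ Ix.
  rewrite normrM mulrA ler_peMl //.
  rewrite -[leLHS](mulVf (lt0r_neq0 D20)).
  by apply: ler_pM => //; rewrite ?invr_ge0 ltW.
have [s1 hs1] : exists s : rat, ratr s \in `]ratr p, r[ by exact: rat_in_itvoo.
have [s2 hs2] : exists s : rat, ratr s \in `]r, ratr q[ by exact: rat_in_itvoo.
rewrite !in_itv /= in hs1 hs2.
have I1 : ratr p < (ratr s1 : R) < ratr q by lra.
have I2 : ratr p < (ratr s2 : R) < ratr q by lra.
have F12 : F (ratr s1) != F (ratr s2).
  apply/eqP => F12; have := F_exp _ _ I1 I2; rewrite F12 subrr normr0 mulr0.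
  by rewrite normr_le0 subr_eq0 => /eqP; lra.
(* The arc from [c] to [d] lies strictly between two values of [F]; with centre [c] and length
   [d - c] this yields the last clause of [chart]. *)
have [c [d [cd m1 m2]]] : exists c d : rat, [/\ c < d,
    Num.min (F (ratr s1)) (F (ratr s2)) < ratr c &
    ratr d < Num.max (F (ratr s1)) (F (ratr s2))].
  have [c] : exists c : rat, ratr c \in
      `]Num.min (F (ratr s1)) (F (ratr s2)), Num.max (F (ratr s1)) (F (ratr s2))[.
    by apply: rat_in_itvoo; move: F12; rewrite neq_lt gt_min !lt_max !ltxx /= orbF.
  rewrite in_itv /= => /andP[mc cm].
  have [d] := rat_in_itvoo cm; rewrite in_itv /= => /andP[cd dm].
  by exists c, d; split => //; rewrite -(ltr_rat R).
have nF (t : R) : ratr p < t < ratr q -> `|F t - clift (h (cproj r))| < 16^-1.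
  by move=> /inI[_ + _]; rewrite /F addrAC subrr add0r.
have liftE (t : R) : ratr p < t < ratr q -> lift_at h (ratr c) t = F t - ratr c.
  move=> It; rewrite /lift_at -FE -cprojB clift_cproj //.
  have := nF _ It; have := nF _ I1; have := nF _ I2.
  rewrite -(ltr_rat R) in cd; move: m1 m2 cd; rewrite gt_min lt_max !ltr_norml.
  by move=> /orP[] ? /orP[] ?; lra.
have lift8 (t : R) : ratr p < t < ratr q -> `|F t - ratr c| <= 8^-1.
  move=> It; have := nF _ It; have := nF _ I1; have := nF _ I2.
  rewrite -(ltr_rat R) in cd; move: m1 m2 cd; rewrite gt_min lt_max !ltr_norml ler_norml.
  by move=> /orP[] ? /orP[] ?; lra.
exists p, q, c, (d - c), L, M; split => //; [exact: ltW|exact: ltW|by rewrite subr_gt0|].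
split.
- by move=> s Is; rewrite liftE // lift8.
- move=> t1 t2 t3 J1 J2 J3; rewrite !liftE //.
  have sub4 (x y z : R) : x - z - (y - z) = x - y by ring.
  rewrite !sub4.
  (* Two mean value points reduce the expression to [u * v * (D x - D y)]. Both are close to
     [ratr t1], so their distance is at most [|u| + |v|]. *)
  have [x [Ix x12 ->]] := mvtF _ _ J1 J2.
  have [y [Iy y13 ->]] := mvtF _ _ J1 J3.
  have xy := D_lip _ _ Iy Ix.
  set u := ratr t2 - ratr t1 in x12 *; set v := ratr t3 - ratr t1 in y13 *.
  have -> : v * (D x * u) - u * (D y * v) = u * v * (D x - D y) by ring.
  rewrite !normrM mulrCA ler_wpM2l ?mulr_ge0 //.
  apply: (le_trans xy); rewrite ler_wpM2l //.
  have -> : x - y = (x - ratr t1) - (y - ratr t1) by ring.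
  by apply: (le_trans (ler_normB _ _)); exact: lerD.
- move=> t1 t2 J1 J2; rewrite !liftE //.
  have -> : F (ratr t2) - ratr c - (F (ratr t1) - ratr c) = F (ratr t2) - F (ratr t1) by ring.
  exact: F_exp.
- have rdc : ratr (d - c) = ratr d - ratr c :> R by rewrite rmorphB.
  move: F12 m1 m2; rewrite neq_lt => /orP[] lt12.
    rewrite (min_l (ltW lt12)) (max_r (ltW lt12)) => m1 m2.
    by exists s1, s2; rewrite !liftE // rdc; split => //; lra.
  rewrite (min_r (ltW lt12)) (max_l (ltW lt12)) => m1 m2.
  by exists s2, s1; rewrite !liftE // rdc; split => //; lra.
Unshelve. all: by end_near. Qed.

End ExistsChart.

(** * Random charts *)

Section MeasurableSets.
Context {R : realType} {d : measure_display} {T : measurableType d}.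

Lemma measurable_forall (I : countType) (Q : I -> T -> Prop) :
  (forall i, measurable [set w | Q i w]) -> measurable [set w | forall i, Q i w].
Proof.
move=> mQ; rewrite (_ : mkset _ = ~` \bigcup_i ~` [set w | Q i w]).
  apply: measurableC; apply: countable_bigcupT_measurable; first exact: countableP.
  by move=> i; apply: measurableC.
apply/seteqP; split => w /=; first by move=> h [i _]; apply; exact: h.
by move=> h i; apply: contrapT => nQ; apply: h; exists i.
Qed.

Lemma measurable_exists (I : countType) (Q : I -> T -> Prop) :
  (forall i, measurable [set w | Q i w]) -> measurable [set w | exists i, Q i w].
Proof.
move=> mQ; rewrite (_ : mkset _ = \bigcup_i [set w | Q i w]).
  by apply: countable_bigcupT_measurable; first exact: countableP.
by apply/seteqP; split => w /= [i]; exists i.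
Qed.

Lemma measurable_imply (p : Prop) (Q : T -> Prop) :
  measurable [set w | Q w] -> measurable [set w | p -> Q w].
Proof.
move=> mQ; have [hp|hp] := pselect p.
  rewrite (_ : mkset _ = [set w | Q w]) //.
  by apply/seteqP; split => w /=; [apply|].
rewrite (_ : mkset _ = setT); first exact: measurableT.
by apply/seteqP; split => w //= _ /hp.
Qed.

Lemma measurable_prop (p : Prop) : measurable [set _ : T | p].
Proof.
have [hp|hp] := pselect p.
  rewrite (_ : mkset _ = setT); first exact: measurableT.
  by apply/seteqP; split.
rewrite (_ : mkset _ = set0); first exact: measurable0.
by apply/seteqP; split.
Qed.

Lemma measurable_and (Q1 Q2 : T -> Prop) :
  measurable [set w | Q1 w] -> measurable [set w | Q2 w] ->
  measurable [set w | Q1 w /\ Q2 w].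
Proof. exact: measurableI. Qed.

Lemma measurable_set_le (f g : T -> R) : measurable_fun setT f ->
  measurable_fun setT g -> measurable [set w | f w <= g w].
Proof.
by move=> mf mg; have := measurable_fun_le measurableT mf mg; rewrite setTI.
Qed.

Lemma measurable_set_lt (f g : T -> R) : measurable_fun setT f ->
  measurable_fun setT g -> measurable [set w | f w < g w].
Proof.
move=> mf mg; rewrite (_ : mkset _ = ~` [set w | g w <= f w]).
  by apply: measurableC; exact: measurable_set_le.
by apply/seteqP; split => w /=; rewrite ltNge => /negP.
Qed.

End MeasurableSets.

Section ChartEvents.
Context {R : realType} {d : measure_display} {T : measurableType d}.

(** [clift] jumps at one point, but its strict superlevel sets are arcs or the whole circle. *)
Lemma measurable_clift_sub (a : R) :
  measurable_fun setT (fun z : circle R => clift (z - cproj a)).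
Proof.
apply: (measurability _ (RGenOInfty.measurableE R)).
move=> _ [_ [c ->] <-]; rewrite setTI.
have [c1|c1] := ltP c (- 2^-1).
  rewrite (_ : _ @^-1` _ = setT); first exact: measurableT.
  apply/seteqP; split => // z _ /=; rewrite in_itv /= andbT.
  by apply: lt_le_trans c1 _; exact: clift_ge.
rewrite (_ : _ @^-1` _ = circle_arc (a + c) (a + 2^-1)).
  exact: measurable_circle_arc.
apply/seteqP; split => z /=; rewrite in_itv /= andbT.
  move=> cz; exists (a + clift (z - cproj a)).
    by rewrite /= in_itv /= !ltrD2l cz clift_lt.
  by rewrite cprojD cliftK addrC subrK.
move=> [r /= + <-]; rewrite in_itv /= => /andP[r1 r2].
by rewrite -cprojB clift_cproj; [lra|apply/andP; split; lra].
Qed.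

Lemma measurable_chart (g : T -> circle R -> circle R) (a p q L M e : R) :
  (forall x, measurable_fun setT (fun w => g w x)) ->
  measurable [set w | chart (g w) a p q L M e].
Proof.
move=> mg.
have mF t : measurable_fun setT (fun w => lift_at (g w) a t).
  exact: (measurableT_comp (measurable_clift_sub a) (mg (cproj t))).
rewrite (_ : mkset _ = [set w | let F s := lift_at (g w) a (ratr s) in
  let I (s : rat) := p < ratr s < q in
  (forall s, I s -> `|F s| <= 8^-1) /\
  ((forall s1 s2 s3, I s1 -> I s2 -> I s3 ->
        `|(ratr s3 - ratr s1) * (F s2 - F s1) - (ratr s2 - ratr s1) * (F s3 - F s1)| <=
        L * (`|ratr s2 - ratr s1| * `|ratr s3 - ratr s1| *
             (`|ratr s2 - ratr s1| + `|ratr s3 - ratr s1|))) /\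
   ((forall s1 s2, I s1 -> I s2 -> `|ratr s2 - ratr s1| <= M * `|F s2 - F s1|) /\
    (exists s1 s2, (I s1 /\ I s2) /\ (F s1 < 0 /\ e < F s2))))]); last first.
  apply/seteqP; split => w /=.
    by move=> [h1 h2 h3 [s1 [s2 [*]]]]; do 3 split => //; exists s1, s2.
  by move=> [h1 [h2 [h3 [s1 [s2 [[? ?] [? ?]]]]]]]; split => //; exists s1, s2.
have mB s t : measurable_fun setT (fun w => lift_at (g w) a s - lift_at (g w) a t).
  exact: measurable_funB.
apply: measurable_and.
  apply: measurable_forall => s; apply: measurable_imply.
  by apply: measurable_set_le => //; exact: measurableT_comp.
apply: measurable_and.
  apply: measurable_forall => s1; apply: measurable_forall => s2.
  apply: measurable_forall => s3; do 3 apply: measurable_imply.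
  apply: measurable_set_le => //; apply: measurableT_comp => //.
  by apply: measurable_funB; apply: measurable_funM.
apply: measurable_and.
  apply: measurable_forall => s1; apply: measurable_forall => s2.
  do 2 apply: measurable_imply.
  apply: measurable_set_le => //; apply: measurable_funM => //.
  exact: measurableT_comp.
apply: measurable_exists => s1; apply: measurable_exists => s2.
apply: measurable_and.
  exact: measurable_prop.
by apply: measurable_and; apply: measurable_set_lt.
Qed.

End ChartEvents.

Lemma circle_leb_arc_gt0 {R : realType} (a b : R) : a < b ->
  (0 < circle_leb (circle_arc a b))%E.
Proof.
move=> ab; pose b' := Num.min b ((Num.floor a)%:~R + 1).
have ab' : a < b' by rewrite lt_min ab -[1]/(1%:~R) -intrD floorD1_gt.
apply: (@lt_le_trans _ _ (circle_leb (circle_arc a b'))).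
  rewrite (circle_leb_arc _ _ (Num.floor a)) ?lte_fin ?subr_gt0 ?floor_le //.
  by rewrite ge_min lexx orbT.
by apply: le_measure; rewrite ?inE; [exact: measurable_circle_arc..|
  apply: circle_arc_sub; rewrite ?ge_min ?lexx].
Qed.

(** * Tracking an arc along a random path *)

Section RandomSteps.
Context {R : realType} {d : measure_display} {X : measurableType d}.
Context {nu : probability X R} {P : probability (paths X) R}.
Hypothesis hP : is_product_measure nu P.
Variable g : paths X -> circle R -> circle R.
Hypotheses (hg : standing g) (h0 : H0 P g) (h1 : H1 P g).
Implicit Types (w : paths X) (C : set (paths X)) (a b : R).

(** [log_dmap] is infinite at critical and at non-differentiability points, so by its integrability
    and Fubini almost every map has a [mu]-null set of such points. An arc is not [mu]-null, as
    Lebesgue measure is dominated by [mu]. *)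
Lemma ae_nonsingular a b : a < b -> {ae P, forall w, exists r : R,
  [/\ a < r < b, differentiable_at (g w) (cproj r) & dmap (g w) (cproj r) != 0]}.
Proof.
move=> ab; have [mu [_ _ [_ leb_mu] intg]] := h1.
have mu_arc : (0 < mu (circle_arc a b))%E.
  rewrite lt0e measure_ge0 andbT; apply/negP => /eqP mu0.
  have := circle_leb_arc_gt0 _ _ ab.
  move/null_content_dominatesP : leb_mu => /(_ _ (measurable_circle_arc a b) mu0) ->.
  by rewrite ltxx.
have [N [mN N0 finN]] := integrable_ae measurableT intg.
have mf := @measurable_fun_xsection _ _ _ _ _ mu N mN.
have : ae_eq P setT (mu \o xsection N) (cst 0%E).
  apply/(ae_eq_integral_abs P measurableT mf); rewrite -[RHS]N0.
  by apply: eq_integral => w _; rewrite gee0_abs.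
apply: filterS => w /(_ I) /= muN; apply: contrapT => nex.
have sub : circle_arc a b `<=` xsection N w.
  move=> _ [r /= + <-]; rewrite in_itv /= => arb; rewrite /xsection /= inE.
  apply: finN => /= /(_ I); rewrite /log_dmap /=.
  have [dr0|dr0] := eqVneq (dmap (g w) (cproj r)) 0.
    by rewrite dr0 normr0 lexx.
  move=> _; apply: nex; exists r; split => //.
  by apply: contrapT => nd; move: dr0; rewrite /dmap asboolF // eqxx.
have : (mu (circle_arc a b) <= mu (xsection N w))%E.
  by apply: le_measure; rewrite ?inE; [exact: measurable_circle_arc|exact: measurable_xsection|].
by rewrite muN leNgt mu_arc.
Qed.

Lemma ae_shift (Q : paths X -> Prop) n : {ae P, forall w, Q w} ->
  {ae P, forall w, Q (iter n (@path_shift d X) w)}.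
Proof.
move=> [N [mN N0 sN]]; exists (iter n (@path_shift d X) @^-1` N); split.
- exact: measurable_shift_preimage.
- by rewrite (measure_shift hP).
- by move=> w nQ; apply: sN.
Qed.

Lemma branch_step a b C k : a < b -> measurable C -> (0 < P C)%E ->
  exists (E : set (paths X)) (c c' e : R), [/\ measurable E, determined 1 E,
    (0 < P (C `&` iter k (@path_shift d X) @^-1` E))%E, c < c' /\ 0 < e &
    forall w, E w -> branch g 1 w (circle_arc a b) (circle_arc c c') e].
Proof.
move=> ab mC PC; have [g0 mg _ _ _] := h0.
pose index : countType := (rat * rat * rat * rat * nat * nat)%type.
(* The side conditions are part of the event, so all tuples can serve as indices; the event is empty
   when they fail. *)
pose E (i : index) : set (paths X) := let: (p, q, c, e, L, M) := i in
  [set w | [&& a <= ratr p, ratr q <= b, 0 < e & (0 < M)%N] /\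
           chart (g w) (ratr c) (ratr p) (ratr q) L%:R M%:R (ratr e)].
have mE i : measurable (E i).
  case: i => [[[[[p q] c] e] L] M].
  apply: (measurableI _ _ (measurable_prop _)); exact: measurable_chart.
have dE i : determined 1 (E i).
  by case: i => [[[[[p q] c] e] L] M] w w' ww'; rewrite /E /= (g0 w w') ?ww'.
have mCE i : measurable (C `&` iter k (@path_shift d X) @^-1` E i).
  by apply: measurableI => //; exact: measurable_shift_preimage.
have [i Pi] : exists i, (0 < P (C `&` iter k (@path_shift d X) @^-1` E i))%E.
  (* Otherwise [C] would be covered, up to a null set, by countably many null events, since almost
     every map at time [k] has a chart with rational data inside the arc. *)
  apply: contrapT => nex.
  have null i : P (C `&` iter k (@path_shift d X) @^-1` E i) = 0%E.
    apply/eqP; rewrite -measure_le0 leNgt; apply/negP => Pi; apply: nex.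
    by exists i.
  pose U n := if @unpickle index n is Some i then
    C `&` iter k (@path_shift d X) @^-1` E i else set0.
  have negU : P.-negligible (\bigcup_n U n).
    apply: negligible_bigcup => n; rewrite /U; case: unpickle => [i|].
      exact: (negligibleP P (mCE i)).2 (null i).
    exact: negligible_set0.
  have := ae_shift _ k (ae_nonsingular _ _ ab) => negB.
  have negC : P.-negligible C.
    apply: negligibleS (negligibleU negU negB) => w Cw.
    have [[r [arb dr Dr]]|nw] := pselect (exists r : R, [/\ a < r < b,
      differentiable_at (g (iter k (@path_shift d X) w)) (cproj r) &
      dmap (g (iter k (@path_shift d X) w)) (cproj r) != 0]); [left|by right].
    have [ch C2h bh] := hg (iter k (@path_shift d X) w).
    have [p [q [c [e [L [M [ap qb e0 M0 hc]]]]]]] := exists_chart _ ch C2h bh _ _ _ arb dr Dr.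
    have [i Ew] : exists i, E i (iter k (@path_shift d X) w).
      by exists (p, q, c, e, L, M); split => //; rewrite ap qb e0 M0.
    by exists (pickle i); [exact: I|rewrite /U pickleK].
  by move: PC; rewrite ((negligibleP P mC).1 negC) ltxx.
move: Pi; case: i => [[[[[p q] c] e] L] M] Pi.
have [|ne] := pselect ([&& a <= ratr p, ratr q <= b, 0 < e & (0 < M)%N]); last first.
  move: Pi; rewrite (_ : _ `&` _ = set0) ?measure0 ?ltxx //.
  by apply/seteqP; split => // w [_ []].
move=> /and4P[ap qb e0 M0].
(* A chart gives derivative at least [M%:R^-1], and [branch] asks for a strict inequality, hence
   [M.+1]. *)
exists (E (p, q, c, e, L, M)), (ratr c), (ratr c + ratr e), (M.+1%:R^-1).
split => //; first by split; rewrite ?ltrDl ?ltr0q ?invr_gt0.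
move=> w [_ hc]; have [ch _ _] := hg w.
have MR : 0 < M%:R :> R by rewrite ltr0n.
have [J [Jpq gJ eJ]] := chart_branch ch hc MR.
exists J; split => //.
  by move=> x /Jpq; exact: circle_arc_sub.
move=> x /eJ[dx ex]; split => //; apply: lt_le_trans ex.
by rewrite ltf_pV2 ?posrE // ltr_nat.
Qed.

(** Step [k] intersects the event with a condition on coordinate [k] alone, so up to time [n] it
    stays determined by the first [n] coordinates. *)
Lemma branch_track n a b C : a < b -> measurable C -> determined n C ->
  (0 < P C)%E -> forall k, (k <= n)%N ->
  exists (C' : set (paths X)) (c c' e : R), [/\ measurable C', determined n C',
    C' `<=` C /\ (0 < P C')%E, c < c' /\ 0 < e &
    forall w, C' w -> branch g k w (circle_arc a b) (circle_arc c c') e].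
Proof.
move=> ab mC dC PC; elim => [_|k IHk kn].
  exists C, a, b, (1 / 2); split => //; first by split => //; lra.
  by move=> w _; apply: branch0; lra.
have [C1 [c [c' [e [mC1 dC1 [C1C PC1] [cc' e0] bC1]]]]] := IHk (ltnW kn).
have [E [c1 [c1' [e1 [mE dE PE [cc1 e10] bE]]]]] := branch_step _ _ _ k cc' mC1 PC1.
exists (C1 `&` iter k (@path_shift d X) @^-1` E), c1, c1', (e1 * e); split.
- by apply: measurableI => //; exact: measurable_shift_preimage.
- apply: determinedI => //; apply: determined_le (determined_shift k 1 _ dE).
  by rewrite addn1.
- by split => // w [/C1C].
- by split => //; rewrite mulr_gt0.
- move=> w [/bC1 b1 /bE b2]; rewrite -addn1.
  exact: branch_comp (ltW e0) (ltW e10) b1 b2.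
Qed.

End RandomSteps.

(** * Full branches *)

Lemma exists_expr_ge {R : realType} (c x : R) : 1 < c -> exists m : nat, x <= c ^+ m.
Proof.
move=> c1; have bern m : 1 + m%:R * (c - 1) <= c ^+ m.
  elim: m => [|m IHm]; first by rewrite mul0r addr0.
  rewrite exprS -natr1; have c0 : 0 <= c by lra.
  apply: le_trans (ler_wpM2l c0 IHm).
  have : 0 <= m%:R * (c - 1) ^+ 2 by rewrite mulr_ge0 ?sqr_ge0.
  by rewrite expr2; lra.
exists (Num.truncn (x / (c - 1))).+1; apply: le_trans (bern _).
have := truncnS_gt (x / (c - 1)); rewrite ltr_pdivrMr ?subr_gt0 //; lra.
Qed.

Section FullBranches.
Context {R : realType} {d : measure_display} {X : measurableType d}.
Context {nu : probability X R} {P : probability (paths X) R}.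
Hypothesis hP : is_product_measure nu P.
Variable g : paths X -> circle R -> circle R.
Hypotheses (hg : standing g) (h0 : H0 P g) (h1 : H1 P g).
Implicit Types (w : paths X) (a b : R).

Variables (kappa0 eta0 : R).
Hypotheses (kappa01 : 1 < kappa0) (eta00 : 0 < eta0).
Hypothesis h4 : forall eta : R, 0 < eta < eta0 ->
  exists (K : nat) (iota : R), 0 < iota < 1 /\
  forall I, circle_interval I ->
    ((eta / 4)%:E <= circle_leb I <= (4 * eta)%:E)%E ->
    (iota%:E < inner_prob P [set w | full_branch_expanding g w kappa0 K I])%E.

(** The event of (H4) may fail to be measurable. Its inner probability provides a measurable subset,
    which [determined_kernel] replaces by one that depends on finitely many coordinates. *)
Lemma full_branch_event a b : a < b ->
  exists (n : nat) (D : set (paths X)), [/\ measurable D, determined n D,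
    (0 < P D)%E & forall w, D w ->
    exists2 i, (i <= n)%N & branch g i w (circle_arc a b) setT kappa0].
Proof.
move=> ab; have [g0 _ _ _ _] := h0.
(* The arc is shortened to fit in one fundamental domain, where its measure is [b' - a], and to make
   this length an admissible [eta] in (H4). *)
pose b' := Num.min b (Num.min ((Num.floor a)%:~R + 1) (a + eta0 / 2)).
have b'b : b' <= b by rewrite ge_min lexx.
have b'1 : b' <= (Num.floor a)%:~R + 1 by rewrite !ge_min lexx orbT.
have b'e : b' <= a + eta0 / 2 by rewrite !ge_min lexx !orbT.
have a1 : a < (Num.floor a)%:~R + 1 by rewrite -[1]/(1%:~R) -intrD floorD1_gt.
have ab' : a < b' by rewrite !lt_min ab a1 /= ltrDl divr_gt0.
have eta : 0 < b' - a < eta0 by lra.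
have [K [iota [/andP[iota0 _] hK]]] := h4 _ eta.
have := hK _ (circle_interval_arc _ _ ab').
rewrite (circle_leb_arc _ _ _ (floor_le a)) // !lee_fin.
set A := [set w | _] => hA.
have iA : (iota%:E < inner_prob P A)%E by apply: hA; lra.
have [_ [B [mB BA] <-] iB] := ereal_sup_gt iA.
have dA : determined K A.
  move=> w w' ww' [J [i [JI iK gJ eJ]]]; exists J, i.
  rewrite -(cocycle_determined _ _ w w' g0) // => j ji.
  by apply: ww'; exact: leq_trans iK.
have PB : (0 < P B)%E by apply: lt_trans iB; rewrite lte_fin.
have [D [mD dD DA PD]] := determined_kernel hP _ _ _ dA mB BA PB.
exists K, D; split => // w /DA /full_branch_expandingP[i iK bi]; exists i => //.
by apply: branchS bi _ _ _ => //; exact: circle_arc_sub.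
Qed.

Variables (c : R).
Hypothesis c1 : 1 < c.

Lemma two_full_branches_event a0 b0 a1 b1 : a0 < b0 -> a1 < b1 ->
  exists (N : nat) (B : set (paths X)), [/\ (0 < N)%N, measurable B,
    determined N B, (0 < P B)%E & forall w, B w ->
    (forall i, branch g 1 (iter i (@path_shift d X) w) setT setT c) ->
    forall n, (N <= n)%N -> branch g n w (circle_arc a0 b0) setT kappa0 /\
                            branch g n w (circle_arc a1 b1) setT kappa0].
Proof.
move=> ab0 ab1.
have [n0 [D0 [mD0 dD0 PD0 bD0]]] := full_branch_event _ _ ab0.
have [C [u [v [e [mC dC [CD0 PC] [uv e0] bC]]]]] :=
  branch_track hP g hg h0 h1 _ _ _ _ ab1 mD0 dD0 PD0 _ (leqnn n0).
have [n1 [D1 [mD1 dD1 PD1 bD1]]] := full_branch_event _ _ uv.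
(* After [m] more steps the factor [c ^+ m] outweighs the loss [e] of the tracking. *)
have [m hm] := exists_expr_ge _ (e^-1) c1.
exists (n0 + n1 + m).+1, (C `&` iter n0 (@path_shift d X) @^-1` D1); split => //.
- by apply: measurableI => //; exact: measurable_shift_preimage.
- apply: determinedI; first by apply: determined_le dC; rewrite leqW // -addnA leq_addr.
  by apply: determined_le (determined_shift n0 n1 _ dD1); rewrite leqW // leq_addr.
- by rewrite (measure_determinedI hP) // mule_gt0.
move=> w [Cw D1w] cw n Nn.
have k0 : 0 <= kappa0 := ltW (lt_trans ltr01 kappa01).
split.
  have [i i0 bi] := bD0 _ (CD0 _ Cw).
  have := branch_setT_extend g c i (n - i) _ _ _ c1 k0 cw bi.
  have ni : (i <= n)%N.
    by apply: leq_trans Nn; rewrite leqW // -addnA (leq_trans i0) // leq_addr.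
  rewrite (subnKC ni) => /branchS; apply => //.
  by rewrite ler_peMl // exprn_ege1 // ltW.
have [i i1 bi] := bD1 _ D1w.
have bi' := branch_comp g _ _ _ _ _ _ _ _ (ltW e0) k0 (bC _ Cw) bi.
have ke : 0 <= kappa0 * e by rewrite mulr_ge0 // ltW.
have := branch_setT_extend g c _ (n - (n0 + i)) _ _ _ c1 ke cw bi'.
have nim : (n0 + i + m <= n)%N.
  by apply: leq_trans Nn; rewrite leqW // leq_add2r leq_add2l.
have ni : (n0 + i <= n)%N by apply: leq_trans nim; rewrite leq_addr.
rewrite (subnKC ni) => /branchS; apply => //.
rewrite mulrCA ler_peMr // -(ler_pdivrMr _ _ e0) div1r; apply: le_trans hm _.
by rewrite ler_eXn2l // leq_subRL.
Qed.

End FullBranches.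

(** * Return times *)

Lemma ae_forall_countable {R : realType} {d : measure_display}
    {T : measurableType d} (P : {measure set T -> \bar R}) (I : countType)
    (Q : I -> T -> Prop) :
  (forall i, {ae P, forall w, Q i w}) -> {ae P, forall w, forall i, Q i w}.
Proof.
move=> aeQ.
have : {ae P, forall w, forall n, if @unpickle I n is Some i then Q i w else True}.
  apply/ae_foralln => n; case: unpickle => [i|]; first exact: aeQ.
  by apply: nearW.
by apply: filterS => w h i; have := h (pickle i); rewrite pickleK.
Qed.

Section VisitTimes.
Context {R : realType} {d : measure_display} {X : measurableType d}.
Variables (N : nat) (B : set (paths X)).

Definition visit_time k (w : paths X) : nat := (N * visit_index N B k w)%N.

Lemma measurable_visit_time k : measurable B -> measurable_fun setT (visit_time k).
Proof.
move=> mB _ Y mY.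
exact: (measurable_visit_index N B mB k measurableT (muln N @^-1` Y) I).
Qed.

Lemma expectation_visit_time {nu : probability X R} {P : probability (paths X) R}
    (p : R) : is_product_measure nu P -> (0 < N)%N -> measurable B ->
  determined N B -> 0 < p -> P B = p%:E ->
  ('E_P[fun w => (visit_time 0 w)%:R] = (N%:R / p)%:E)%E.
Proof.
move=> hP N0 mB dB p0 PB; rewrite unlock /visit_time.
under eq_integral do rewrite natrM EFinM.
rewrite (ge0_integralZl P measurableT); last 3 first.
- apply/measurable_EFinP.
  apply: (@measurableT_comp _ _ _ _ _ _ (fun n : nat => n%:R : R)) => //.
  exact: measurable_visit_index.
- by move=> w _; rewrite lee_fin.
- by rewrite lee_fin.
by rewrite (expectation_visit_index N B mB hP p N0 dB p0 PB) EFinM.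
Qed.

Context (p : R) (w : paths X).
Hypotheses (p0 : 0 < p) (vw : (visits N B k w)%:R / k%:R @[k --> \oo] --> p).

Lemma cvg_visit_time :
  (((visit_time k w)%:R / k%:R)%:E : \bar R) @[k --> \oo] --> (N%:R / p)%:E.
Proof.
apply: cvg_EFin; first exact: nearW.
have h := cvg_visit_index N B p p0 w vw.
have : (N%:R * ((visit_index N B k w)%:R / k%:R) : R) @[k --> \oo] --> N%:R * p^-1.
  by apply: cvgM; [exact: cvg_cst|exact: h].
apply: cvg_trans; apply: near_eq_cvg; apply: nearW => k /=.
by rewrite /visit_time natrM mulrA.
Qed.

(** At every return time the shifted path lies in [B], and consecutive return times are at least [N]
    apart. By then both arcs have a full branch, which restricts to a branch onto either
    interval. *)
Lemma visit_time_horseshoe (g : paths X -> circle R -> circle R) (kappa c : R)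
    (A : bool -> set (circle R)) (I0 I1 : set (circle R)) : (0 < N)%N ->
  (forall v, B v ->
    (forall i, branch g 1 (iter i (@path_shift d X) v) setT setT c) ->
    forall n, (N <= n)%N -> forall i, branch g n v (A i) setT kappa) ->
  (forall i, branch g 1 (iter i (@path_shift d X) w) setT setT c) ->
  A false `<=` I0 -> A true `<=` I1 ->
  horseshoe_times g I0 I1 w kappa (visit_time ^~ w).
Proof.
move=> N0 full_A cw A0 A1; split.
- by move=> k l kl; rewrite /visit_time ltn_pmul2l // (visit_index_lt _ _ p p0 w vw).
- have h := cvg_visit_time; rewrite is_cvg_limn_esupE.
    by rewrite (cvg_lim _ h) // ltry.
  by apply/cvg_ex; exists (N%:R / p)%:E.
- pose I b := if b then I1 else I0.
  have AI b : A b `<=` I b by case: b.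
  have J k i j : branch g (visit_time k.+1 w - visit_time k w)
      (iter (visit_time k w) (@path_shift d X) w) (I i) (I j) kappa.
    have Bk : B (iter (visit_time k w) (@path_shift d X) w).
      exact: visit_index_hit _ _ p p0 w vw k.
    have ck m : branch g 1 (iter m (@path_shift d X)
        (iter (visit_time k w) (@path_shift d X) w)) setT setT c.
      by rewrite -iterD; exact: cw.
    have Nk : (N <= visit_time k.+1 w - visit_time k w)%N.
      rewrite /visit_time -mulnBr leq_pmulr // subn_gt0.
      exact: visit_index_lt _ _ p p0 w vw _ _ (ltnSn k).
    apply: branchS (full_A _ Bk ck _ Nk i) (AI i) _ _ => //.
  exists (fun k i j => sval (cid (J k i j))) => k i j /=.
  by case: cid.
Qed.

End VisitTimes.

Theorem theorem2p6 (R : realType) (d : measure_display) (X : measurableType d)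
    (nu : probability X R) (P : probability (paths X) R)
    (hP : is_product_measure nu P)
    (g : paths X -> circle R -> circle R)
    (hg : standing g) (h0 : H0 P g) (h1 : H1 P g) (h2 : H2 P g) (h3 : H3 P g)
    (h4 : H4 P g) (h5 : H5 P g) :
  exists (Omega' : set (paths X)) (kappa : R),
    [/\ measurable Omega', P Omega' = 1%E, 1 < kappa &
    forall I0 I1 : set (circle R),
      circle_interval I0 -> circle_interval I1 -> I0 `&` I1 = set0 ->
      (forall w, Omega' w -> horseshoe g I0 I1 w kappa) /\
      exists n : nat -> paths X -> nat,
        [/\ forall k, measurable_fun setT (n k),
            forall w, Omega' w -> horseshoe_times g I0 I1 w kappa (fun k => n k w) &
            {ae P, forall w,
              ((n k w)%:R / k%:R)%:E @[k --> \oo] -->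
              'E_P[fun w' => (n 0%N w')%:R]%E}]].
Proof.
have [kappa k1 [eta0 eta00 {}h4]] := h4.
have [c0 c01 {}h5] := h5.
(* The bound in (H5) is not strict while that in [branch] is, so a constant strictly between 1 and
   [c0] is used. *)
pose c := (1 + c0) / 2.
have c1 : 1 < c by rewrite /c; lra.
have cc0 : c < c0 by rewrite /c; lra.
have ae_branch : {ae P, forall w, branch g 1 w setT setT c}.
  move: h5; apply: filterS => w [I [_ gI eI]].
  by exists I; split => // x /eI[dx cx]; split => //; exact: lt_le_trans cx.
have ae_branches : {ae P, forall w, forall i, branch g 1 (iter i (@path_shift d X) w) setT setT c}.
  by apply/ae_foralln => i; exact: (ae_shift hP _ i ae_branch).
pose index : countType := (rat * rat * rat * rat)%type.
pose ends (q : index) : Prop := let: (a0, b0, a1, b1) := q in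
  ratr a0 < ratr b0 :> R /\ ratr a1 < ratr b1 :> R.
pose arcs (q : index) (i : bool) : set (circle R) := let: (a0, b0, a1, b1) := q in
  if i then circle_arc (ratr a1) (ratr b1) else circle_arc (ratr a0) (ratr b0).
have /choice[NB hNB] : forall q : index, exists NB : nat * set (paths X), ends q ->
    [/\ (0 < NB.1)%N, measurable NB.2, determined NB.1 NB.2, (0 < P NB.2)%E &
    forall w, NB.2 w ->
    (forall i, branch g 1 (iter i (@path_shift d X) w) setT setT c) ->
    forall n, (NB.1 <= n)%N -> forall i, branch g n w (arcs q i) setT kappa].
  move=> [[[a0 b0] a1] b1].
  (* Tuples that do not describe two arcs get a dummy value. *)
  have [[ab0 ab1]|nab] := pselect (ends (a0, b0, a1, b1)); last by exists (0%N, set0).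
  have [N [B [N0 mB dB PB hB]]] :=
    two_full_branches_event hP g hg h0 h1 kappa eta0 k1 eta00 h4 c c1 _ _ _ _ ab0 ab1.
  exists (N, B) => _; split => // w Bw cw n Nn i.
  by have [h0' h1'] := hB w Bw cw n Nn; case: i.
pose p q := fine (P (NB q).2).
have pE q : ends q -> P (NB q).2 = (p q)%:E.
  by move=> /hNB[_ mB _ _ _]; rewrite fineK // fin_num_measure.
have ae_freq : {ae P, forall w, forall q : index, ends q ->
    (visits (NB q).1 (NB q).2 k w)%:R / k%:R @[k --> \oo] --> p q}.
  apply: ae_forall_countable => q.
  have [eq|neq] := pselect (ends q); last by apply: nearW => w /neq.
  have [N0 mB dB PB _] := hNB q eq.
  have pq0 : 0 < p q by rewrite -lte_fin -pE.
  have := ae_visits _ _ mB hP _ N0 dB pq0 (pE q eq).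
  by apply: filterS => w vw _.
(* One null set for all tuples of rational endpoints, chosen before the intervals are given. *)
have [M [mM M0 sM]] := filterI ae_branches ae_freq.
have good w : (~` M) w ->
    (forall i, branch g 1 (iter i (@path_shift d X) w) setT setT c) /\
    forall q : index, ends q ->
      (visits (NB q).1 (NB q).2 k w)%:R / k%:R @[k --> \oo] --> p q.
  by move=> nMw; apply: contrapT => ng; apply/nMw/sM.
exists (~` M), kappa; split => //; first exact: measurableC.
  by rewrite probability_setC // M0 sube0.
move=> I0 I1 [_ nI0] [_ nI1] _.
have [a0 [b0 [ab0 sub0]]] := open_contains_arc _ (open_interior I0) nI0.
have [a1 [b1 [ab1 sub1]]] := open_contains_arc _ (open_interior I1) nI1.
have [q eq [A0 A1]] : exists2 q : index, ends q & arcs q false `<=` I0 /\ arcs q true `<=` I1.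
  exists (a0, b0, a1, b1) => //; split.
    exact: subset_trans sub0 (@interior_subset _ _).
  exact: subset_trans sub1 (@interior_subset _ _).
have [N0 mB dB PB full] := hNB q eq.
have pq0 : 0 < p q by rewrite -lte_fin -pE.
have hor w : (~` M) w ->
    horseshoe_times g I0 I1 w kappa (visit_time (NB q).1 (NB q).2 ^~ w).
  move=> /good[bw /(_ q eq) vw].
  exact: (visit_time_horseshoe _ _ _ _ pq0 vw _ _ _ _ _ _ N0 full bw A0 A1).
split; first by move=> w /hor; exists (visit_time (NB q).1 (NB q).2 ^~ w).
exists (visit_time (NB q).1 (NB q).2); split => //.
  by move=> k; exact: measurable_visit_time.
rewrite (expectation_visit_time _ _ _ hP N0 mB dB pq0 (pE q eq)).
exists M; split => // w nw; apply: contrapT => nMw; apply: nw.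
by have [_ /(_ q eq) vw] := good w nMw; exact: cvg_visit_time.
Qed.
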